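(* For every integer $n\ge 6$, $$ex_3(n;P^3_3|C^3_3)=20+ex_3(n-6;P^3_3).$$ Moreover, up to isomorphism, the only element of $Ex_3(n;P^3_3|C^3_3)$ is the disjoint union of $K^3_6$ and the unique (up to isomorphism) $P^3_3$-free 3-graph on $n-6$ vertices with $ex_3(n-6;P^3_3)$ edges.
   Context: A 3-graph is a pair $H=(V,E)$ with $V$ a finite set and $E\subseteq\binom V3$ (the edges); isolated vertices are allowed. A 3-graph is $F$-free if it contains no subhypergraph isomorphic to $F$ (not necessarily induced). The Turán number $ex_3(n;F)$ is the maximum number of edges of an $F$-free 3-graph on $n$ vertices, with the convention $ex_3(0;F)=0$. $P^3_3$ is the linear path of length 3: the 3-graph with three edges $e_1,e_2,e_3$ such that $|e_1\cap e_2|=|e_2\cap e_3|=1$ and $e_1\cap e_3=\emptyset$ (7 vertices). $C^3_3$ is the triangle: the 3-graph on 6 vertices $a,b,c,d,e,f$ with the three edges $\{a,b,c\},\{c,d,e\},\{e,f,a\}$. $K^3_m$ is the complete 3-graph on $m$ vertices (all $\binom m3$ triples; just $m$ isolated vertices if $m<3$), and $S^3_m$ is the full star on $m$ vertices (all $\binom{m-1}2$ triples containing one fixed vertex). $ex_3(n;P^3_3|C^3_3)$ denotes the largest number of edges in an $n$-vertex $P^3_3$-free 3-graph that contains a copy of $C^3_3$ as a subhypergraph, and $Ex_3(n;P^3_3|C^3_3)$ is the set of all pairwise non-isomorphic $n$-vertex $P^3_3$-free 3-graphs containing a copy of $C^3_3$ and having exactly $ex_3(n;P^3_3|C^3_3)$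 edges. The unique $P^3_3$-free 3-graph on $m$ vertices with $ex_3(m;P^3_3)$ edges is $K^3_m$ for $m\le 6$, the disjoint union $K^3_6\cup K^3_1$ for $m=7$, and $S^3_m$ for $m\ge 8$ (for $m=0$ it is the 3-graph with no vertices). *)

(* Defs.v *)
From HB Require Import structures.
From mathcomp Require Import all_boot.

Set Implicit Arguments.
Unset Strict Implicit.
Unset Printing Implicit Defensive.

Record graph3 (V : finType) := Graph3 {
  edges : {set {set V}};
  edges3 : [forall e in edges, #|e| == 3]
}.

HB.instance Definition _ (V : finType) := [isSub for @edges V].
HB.instance Definition _ (V : finType) := [Finite of graph3 V by <:].

(* The copy of F in H need not be induced. *)
Definition contains (W V : finType) (F : graph3 W) (H : graph3 V) : bool :=
  [exists f : {ffun W -> V},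
     injectiveb f && [forall e in edges F, f @: e \in edges H]].

Definition iso (V W : finType) (H : graph3 V) (K : graph3 W) : Prop :=
  exists f : V -> W,
    bijective f /\ forall e : {set V}, (f @: e \in edges K) = (e \in edges H).

Definition ex3 (W : finType) (n : nat) (F : graph3 W) : nat :=
  \max_(H : graph3 'I_n | ~~ contains F H) #|edges H|.

(* ex3_cond n F G is ex_3(n; F | G); it is 0 when no F-free 3-graph on n
   vertices contains G. *)
Definition ex3_cond (W U : finType) (n : nat) (F : graph3 W) (G : graph3 U)
    : nat :=
  \max_(H : graph3 'I_n | ~~ contains F H && contains G H) #|edges H|.

Definition Ex3 (W V : finType) (n : nat) (F : graph3 W) (H : graph3 V) : Prop :=
  [/\ #|V| = n, ~~ contains F H & #|edges H| = ex3 n F].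

(* Membership of (the isomorphism class of) H in Ex_3(n; F | G). *)
Definition Ex3_cond (W U V : finType) (n : nat) (F : graph3 W) (G : graph3 U)
    (H : graph3 V) : Prop :=
  [/\ #|V| = n, ~~ contains F H, contains G H & #|edges H| = ex3_cond n F G].

Lemma complete3_subproof (m : nat) :
  [forall e in [set e : {set 'I_m} | #|e| == 3], #|e| == 3].
Proof. by apply/forall_inP => e; rewrite inE. Qed.

Definition complete3 (m : nat) : graph3 'I_m := Graph3 (complete3_subproof m).

Definition dunion_edges (V W : finType) (H : graph3 V) (K : graph3 W) :
    {set {set V + W}} :=
  [set inl @: e | e : {set V} in edges H]
    :|: [set inr @: e | e : {set W} in edges K].

Lemma dunion_subproof (V W : finType) (H : graph3 V) (K : graph3 W) :
  [forall e in dunion_edges H K, #|e| == 3].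
Proof.
apply/forall_inP => e; rewrite inE => /orP[] /imsetP[d dE ->].
- by rewrite card_imset; [exact: (forall_inP (edges3 H)) | move=> x y []].
- by rewrite card_imset; [exact: (forall_inP (edges3 K)) | move=> x y []].
Qed.

Definition dunion (V W : finType) (H : graph3 V) (K : graph3 W) :
    graph3 (V + W)%type :=
  Graph3 (dunion_subproof H K).

Definition triple (m i j k : nat) : {set 'I_m.+1} :=
  [set inord i; inord j; inord k].

Lemma card_triple (m i j k : nat) :
  i < j -> j < k -> k <= m -> #|triple m i j k| = 3.
Proof.
move=> ij jk km; have jm := leq_trans (ltnW jk) km.
have im := leq_trans (ltnW ij) jm.
have ik := ltn_trans ij jk.
rewrite /triple setUC cardsU1 cards2 !inE.
rewrite -!(inj_eq val_inj) /= !inordK ?ltnS //.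
by rewrite !(gtn_eqF ik, gtn_eqF jk, ltn_eqF ij).
Qed.

Definition P33_edges : {set {set 'I_7}} :=
  [set triple 6 0 1 2; triple 6 2 3 4; triple 6 4 5 6].

Lemma P33_subproof : [forall e in P33_edges, #|e| == 3].
Proof.
by apply/forall_inP => e; rewrite !inE => /orP[/orP[]|] /eqP->;
  rewrite card_triple.
Qed.

Definition P33 : graph3 'I_7 := Graph3 P33_subproof.

(* The edges abc, cde, efa with (a, b, c, d, e, f) = (0, 1, 2, 3, 4, 5). *)
Definition C33_edges : {set {set 'I_6}} :=
  [set triple 5 0 1 2; triple 5 2 3 4; triple 5 0 4 5].

Lemma C33_subproof : [forall e in C33_edges, #|e| == 3].
Proof.
by apply/forall_inP => e; rewrite !inE => /orP[/orP[]|] /eqP->;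
  rewrite card_triple.
Qed.

Definition C33 : graph3 'I_6 := Graph3 C33_subproof.

(* Main.v *)
Require Import Defs.
From mathcomp Require Import all_boot zify.

(** Why the theorem holds.

    Let H be a 3-graph on n vertices without loose path of length 3 that contains
    a triangle abc, cde, efa, and let U be the set of its six vertices.  Looking
    for paths that use two edges of the triangle shows that every edge meets U in
    0, 2 or 3 vertices, and in the second case in one of six pairs: ac, ce, ea, ad,
    cf, eb.  Let X be the set of the outer vertices lying on such an edge.  An edge
    disjoint from U also avoids X.  If X is empty, H is the disjoint union of a
    3-graph on U and a path-free 3-graph on the other n - 6 vertices, so it has at
    most 20 + ex(n - 6) edges, with equality only for a complete and an extremal
    part.  If X has t > 0 vertices, a single edge meeting U in two vertices already
    destroys nine of the twenty triples of U, while two different vertices of X lie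
    on at most 6 edges meeting U in total.  So at most 11 + 3t edges meet U (17 if
    t = 1), which is less than 20 + ex(t), and ex(t) + ex(n - 6 - t) is at most
    ex(n - 6) because the function ex is superadditive.  This is
    [triangle_dichotomy].

    It remains to know ex and that its extremal 3-graphs are unique
    ([turan_path]).  The proof is by induction on the number m of vertices.  Up to
    6 vertices there is no path at all.  If a triangle occurs, the first paragraph
    and the induction hypothesis give the bound 20 + ex(m - 6), which is attained
    for m = 7 only.  Otherwise there is neither a loose path nor a loose triangle,
    and [loose_free_bound] shows that there are at most C(m - 1, 2) edges, with
    equality only for a full star once m >= 8.

    For [loose_free_bound] the two excluded configurations combine into one rule
    ([loose_free]): if two edges meet a third edge xyz exactly in x and exactly in
    y, then they agree outside xyz.  Hence for an edge xyz either no edge, or only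
    edges through one of its vertices, or at most three edges with a common pair
    outside, meet xyz in a single vertex.  In each case the edges are counted
    according to their intersection with xyz.

    The families of triples obtained in this way are determined by a partition of
    the vertices into the set U, the apex (centre of the star, or isolated vertex)
    and the rest; a bijection respecting two such partitions is an isomorphism
    ([split_iso]). *)

Set Implicit Arguments.
Unset Strict Implicit.
Unset Printing Implicit Defensive.

(** * Families of triples *)

Section Families.
Variable V : finType.
Implicit Types (F : {set {set V}}) (S R e p : {set V}) (x y z w : V).

Definition edge F (x y z : V) := [set x; y; z] \in F.

Definition inside F S := [set e in F | e \subset S].

Definition graph_on F S := forall e, e \in F -> e \subset S /\ #|e| = 3.

(** The link of [x] restricted to [R]: the edges meeting the complement of [R] in
    [x] only, with [x] removed. *)
Definition pairs_at F R (x : V) := [set p : {set V} | (p \subset R) && (x |: p \in F)].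

Definition thirds F R (x y : V) := [set w in R | edge F x y w].

Lemma edgeC F x y z : edge F x y z = edge F y x z.
Proof. by rewrite /edge (setUC [set x]). Qed.

Lemma edgeCA F x y z : edge F x y z = edge F x z y.
Proof. by rewrite /edge setUAC. Qed.

Lemma card3P e : #|e| = 3 -> exists x y z, e = [set x; y; z].
Proof.
move=> e3; have /card_gt0P[x xe] : 0 < #|e| by rewrite e3.
have : #|e :\ x| == 2 by have := cardsD1 x e; rewrite xe e3; lia.
move/cards2P=> [y [z [_ eyz]]]; exists x, y, z.
by rewrite -(setD1K xe) eyz setUA.
Qed.

Lemma card3_uniq x y z : (#|[set x; y; z]| == 3) = uniq [:: x; y; z].
Proof.
rewrite -setUA cardsU1 cards2 !inE /= !inE andbT.
by case: (x == y); case: (x == z); case: (y == z).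
Qed.

Lemma graph_on_inside F S R : graph_on F S -> graph_on (inside F R) R.
Proof. by move=> gF e; rewrite inE => /andP[/gF[_ ?] ?]. Qed.

Lemma edge_neq F S x y z : graph_on F S -> edge F x y z ->
  [/\ x != y, x != z & y != z].
Proof.
move=> gF /gF[_ /eqP]; rewrite card3_uniq /= !inE negb_or andbT.
by case/andP=> /andP[? ?] ?.
Qed.

Lemma edge_in F S x y z : graph_on F S -> edge F x y z ->
  [/\ x \in S, y \in S & z \in S].
Proof.
by move=> gF /gF[/subsetP sub _]; split; apply: sub; rewrite !inE eqxx ?orbT.
Qed.

End Families.

(** Closes a goal [edge F a b c] by a hypothesis listing the same three vertices in
    another order. *)
Ltac tri := match goal with
 |- is_true (edge ?F ?a ?b ?c) => match goal with
   | H : is_true (edge F a b c) |- _ => exact H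
   | H : is_true (edge F a c b) |- _ => rewrite edgeCA; exact H
   | H : is_true (edge F b a c) |- _ => rewrite edgeC; exact H
   | H : is_true (edge F b c a) |- _ => rewrite edgeC edgeCA; exact H
   | H : is_true (edge F c a b) |- _ => rewrite edgeCA edgeC; exact H
   | H : is_true (edge F c b a) |- _ => rewrite edgeC edgeCA edgeC; exact H
 end end.

Ltac neq := first [assumption | rewrite eq_sym; assumption].

Section EdgeCover.
Variable V : finType.
Implicit Types (F : {set {set V}}) (S R e p : {set V}) (x y z w : V).

(** The edges are sorted by their trace on the edge [xyz]: all of it, two of its
    vertices, one of them, or none. *)
Lemma edge_cover_sub F S x y z (R := S :\: [set x; y; z]) :
  graph_on F S -> edge F x y z ->
  F \subset [set [set x; y; z]] :|: [set [set y; z; w] | w in thirds F R y z]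
  :|: [set [set x; z; w] | w in thirds F R x z]
  :|: [set [set x; y; w] | w in thirds F R x y]
  :|: [set x |: p | p : {set V} in pairs_at F R x]
  :|: [set y |: p | p : {set V} in pairs_at F R y]
  :|: [set z |: p | p : {set V} in pairs_at F R z] :|: inside F R.
Proof.
move=> gF Exyz; have [nxy nxz nyz] := edge_neq gF Exyz.
apply/subsetP=> e eF; have [/subsetP eS e3] := gF e eF.
have two u v w : u != v -> u \in e -> v \in e -> w \notin e ->
    [set u; v; w] = [set x; y; z] -> exists2 t, t \in thirds F R u v & e = [set u; v; t].
  move=> nuv ue ve we xyz.
  have /eqP/cards1P[t et] : #|e :\: [set u; v]| = 1.
    have := cardsID [set u; v] e; rewrite e3 (setIidPr _); last first.
      by apply/subsetP=> s; rewrite !inE => /orP[]/eqP->.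
    by rewrite cards2 nuv; lia.
  have: t \in e :\: [set u; v] by rewrite et inE.
  rewrite !inE negb_or => /andP[/andP[tu tv] te].
  have E : e = [set u; v; t].
    apply/esym/eqP; rewrite eqEcard e3; apply/andP; split.
      by apply/subsetP=> s; rewrite !inE => /orP[/orP[]|] /eqP->.
    by rewrite eq_leq // (eqP (_ : #|_| == 3)) // card3_uniq /= !inE negb_or nuv !(eq_sym _ t) tu
      tv.
  exists t; rewrite // inE /edge -E eF andbT in_setD eS // andbT -xyz !inE !negb_or tu tv.
  by apply: contraNneq we => <-.
have one u : [set x; y; z] :&: e = [set u] -> e \in [set u |: p | p : {set V} in pairs_at F R u].
  move=> eu; have ue : u \in e by have := set11 u; rewrite -eu inE => /andP[].
  apply/imsetP; exists (e :\ u); last by rewrite setD1K.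
  rewrite inE setD1K // eF andbT; apply/subsetP=> s; rewrite !inE => /andP[su se].
  rewrite eS // andbT; apply: contraNN su => sxyz.
  have : s \in [set x; y; z] :&: e by rewrite !inE sxyz se.
  by rewrite eu inE.
have yzx : [set y; z; x] = [set x; y; z] by rewrite setUC setUA.
rewrite !in_setU.
have [xe|xe] := boolP (x \in e); have [ye|ye] := boolP (y \in e); have [ze|ze] := boolP (z \in e).
- have -> : e = [set x; y; z]; last by rewrite inE eqxx.
  apply/esym/eqP; rewrite eqEcard e3; apply/andP; split.
    by apply/subsetP=> s; rewrite !inE => /orP[/orP[]|] /eqP->.
  by have [_ ->] := gF _ Exyz.
- have [t tt ->] := two x y z nxy xe ye ze erefl.
  by rewrite (imset_f (fun w => [set x; y; w]) tt) ?orbT.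
- have [t tt ->] := two x z y nxz xe ze ye (setUAC _ _ _).
  by rewrite (imset_f (fun w => [set x; z; w]) tt) ?orbT.
- rewrite one ?orbT //; apply/setP=> s; rewrite !inE.
  case: eqP => [->|] /=; first by rewrite xe.
  by case: eqP => [->|_] /=; [rewrite (negbTE ye)|case: eqP => [->|//]; rewrite (negbTE ze)].
- have [t tt ->] := two y z x nyz ye ze xe yzx.
  by rewrite (imset_f (fun w => [set y; z; w]) tt) ?orbT.
- rewrite (one y) ?orbT //; apply/setP=> s; rewrite !inE.
  case: (s =P y) => [->|] /=; first by rewrite ye ?orbT.
  by case: eqP => [->|_] /=; [rewrite (negbTE xe)|case: eqP => [->|//]; rewrite (negbTE ze)].
- rewrite (one z) ?orbT //; apply/setP=> s; rewrite !inE.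
  case: (s =P z) => [->|] /=; first by rewrite ze ?orbT.
  by case: eqP => [->|_] /=; [rewrite (negbTE xe)|case: eqP => [->|//]; rewrite (negbTE ye)].
- have -> : e \in inside F R; last by rewrite !orbT.
  rewrite inE eF; apply/subsetP=> s se; rewrite !inE eS // andbT.
  by apply/negP=> /orP[/orP[]|] /eqP sx; move: se;
    rewrite sx ?(negbTE xe) ?(negbTE ye) ?(negbTE ze).
Qed.

Lemma edge_cover F S x y z (R := S :\: [set x; y; z]) :
  graph_on F S -> edge F x y z ->
  #|F| <= 1 + #|thirds F R y z| + #|thirds F R x z| + #|thirds F R x y| +
     #|pairs_at F R x| + #|pairs_at F R y| + #|pairs_at F R z| + #|inside F R|.
Proof.
move=> gF Exyz; apply: leq_trans (subset_leq_card (edge_cover_sub gF Exyz)) _.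
by do 7![apply: leq_trans (leq_card_setU _ _) _; apply: leq_add; last by rewrite ?leq_imset_card];
  rewrite cards1.
Qed.
End EdgeCover.

(** * Families without loose paths and loose triangles *)

Section LooseFree.
Variable V : finType.
Implicit Types (F : {set {set V}}) (S R e p q : {set V}) (x y z w u c d : V).

(** The edges [xcd] and [yab] meet the edge [xyz] in [x] and in [y] only.  If the
    pairs [cd] and [ab] are disjoint, the three edges form a loose path; if they
    share one vertex, a loose triangle.  Excluding both leaves [cd] = [ab]; since [c]
    and [d] can be exchanged, it is enough to say that [c] is [a] or [b]. *)
Definition loose_free F := forall x y z c d a b,
  edge F x c d -> edge F x y z -> edge F y a b ->
  c != y -> c != z -> d != y -> d != z -> a != x -> a != z -> b != x -> b != z ->
  (c == a) || (c == b).

Lemma card_le_draws F S : graph_on F S -> #|F| <= 'C(#|S|, 3).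
Proof.
move=> gF; rewrite -cards_draws subset_leq_card //.
by apply/subsetP=> e /gF[eS e3]; rewrite inE eS e3 eqxx.
Qed.

Lemma thirdsC F R x y : thirds F R x y = thirds F R y x.
Proof. by apply/setP=> w; rewrite !inE edgeC. Qed.

Lemma card_thirds F R x y : #|thirds F R x y| <= #|R|.
Proof. by rewrite subset_leq_card //; apply/subsetP=> w; rewrite inE => /andP[]. Qed.

Lemma pairs_atP F S R x p : graph_on F S -> x \notin R -> p \in pairs_at F R x ->
  exists c d, [/\ p = [set c; d], c \in R, d \in R, c != d & edge F x c d].
Proof.
move=> gF xR; rewrite inE => /andP[/subsetP pR xp]; have [_ p3] := gF _ xp.
have xNp : x \notin p by apply: contraNN xR => /pR.
have /cards2P[c [d [ncd pcd]]] : #|p| == 2 by move: p3; rewrite cardsU1 xNp; lia.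
exists c, d; split => //; try by apply: pR; rewrite pcd !inE eqxx ?orbT.
by rewrite /edge -setUA -pcd.
Qed.

Lemma card_pairs_inside F R x : x \notin R ->
  #|pairs_at F R x| + #|inside F R| <= #|inside F (x |: R)|.
Proof.
move=> xR; rewrite -(card_in_imset (f := fun p => x |: p) (D := mem (pairs_at F R x))).
  rewrite -cardsUI (_ : _ :&: _ = set0) ?cards0 ?addn0.
    apply/subset_leq_card/subsetP=> e; rewrite in_setU => /orP[/imsetP[p]|].
      by rewrite inE => /andP[pR xp] ->; rewrite inE xp setUS.
    by rewrite !inE => /andP[-> /subset_trans->]; rewrite ?subsetUr.
  apply/setP=> e; rewrite [RHS]inE; apply/negP; rewrite inE => /andP[/imsetP[p _ ->]].
  by rewrite inE => /andP[_ /subsetP/(_ x)]; rewrite !inE eqxx (negbTE xR) => /(_ isT).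
have xN p : p \in pairs_at F R x -> x \notin p.
  by rewrite inE => /andP[/subsetP pR _]; apply: contraNN xR => /pR.
by move=> p q /xN xp /xN xq /= E; rewrite -(setU1K xp) E setU1K.
Qed.

Section AtAnEdge.
Variables (F : {set {set V}}) (S R : {set V}).
Hypothesis gF : graph_on F S.
Hypothesis LF : loose_free F.

(** The path [ycd], [xyw], [xzu] is the situation of [loose_free] with middle edge
    [xyw]; as [z] is not in [cd], the pairs [cd] and [zu] differ, so [w = u] is
    the only way out. *)
Lemma loose_third x y w z u c d : edge F y c d -> edge F x y w -> edge F x z u ->
  c != x -> c != z -> d != x -> d != z -> w != c -> w != d -> w != z ->
  z != y -> u != y -> u = w.
Proof.
move=> ycd xyw xzu cx cz dx dz wc wd wz zy uy.
have [_ _ ncd] := edge_neq gF ycd.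
case: (u =P w) => // /eqP uw.
have /orP[|/eqP cu] : (c == z) || (c == u).
- by apply: (@LF y x w c d z u) => //; first [tri | neq].
- by rewrite (negbTE cz).
have /orP[|/eqP du] : (d == z) || (d == u).
- by apply: (@LF y x w d c z u) => //; first [tri | neq].
- by rewrite (negbTE dz).
by rewrite cu du eqxx in ncd.
Qed.

Lemma pairs_at_eq x y z p q : edge F x y z ->
  (forall w, w \in R -> [/\ w != x, w != y & w != z]) ->
  p \in pairs_at F R x -> q \in pairs_at F R y -> p = q.
Proof.
move=> xyz Rn px qy.
have xR : x \notin R by apply/negP=> /Rn[]; rewrite eqxx.
have yR : y \notin R by apply/negP=> /Rn[_]; rewrite eqxx.
have [c [d [-> /Rn[? ? ?] /Rn[? ? ?] ncd xcd]]] := pairs_atP gF xR px.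
have [a [b [-> /Rn[? ? ?] /Rn[? ? ?] nab yab]]] := pairs_atP gF yR qy.
have cab : (c == a) || (c == b) by apply: (@LF x y z c d a b).
have dab : (d == a) || (d == b) by apply: (@LF x y z d c a b) => //; tri.
case/orP: cab => /eqP E; case/orP: dab => /eqP E'; subst => //.
- by rewrite eqxx in ncd.
- by rewrite setUC.
- by rewrite eqxx in ncd.
Qed.

(** An edge [e] containing [c] but not [d] would continue the path [xyz], [xcd]:
    the pairs [yz] and [e] minus [c] are disjoint, which [loose_free] forbids. *)
Lemma inside_pair x y z c d e : edge F x y z -> edge F x c d ->
  (forall w, w \in R -> [/\ w != x, w != y & w != z]) ->
  c \in R -> d \in R -> e \in inside F R -> c \in e -> d \in e.
Proof.
move=> xyz xcd Rn cR dR; rewrite inE => /andP[eF /subsetP eR] ce.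
have [_ _ ncd] := edge_neq gF xcd.
apply: contraT => de; have [_ e3] := gF eF.
have /cards2P[a [b [nab eab]]] : #|e :\ c| == 2 by have := cardsD1 c e; rewrite ce e3; lia.
have [ca cb aR [bR ad bd]] : [/\ c != a, c != b, a \in R & [/\ b \in R, a != d & b != d]].
  have : a \in e :\ c by rewrite eab !inE eqxx.
  have : b \in e :\ c by rewrite eab !inE eqxx orbT.
  rewrite !inE => /andP[bc be] /andP[ac ae]; split;
    [by rewrite eq_sym | by rewrite eq_sym | exact: eR | split; first exact: eR].
  - by apply: contraNneq de => <-.
  - by apply: contraNneq de => <-.
have cab : edge F c a b by rewrite /edge -setUA -eab setD1K.
have [? ? ?] := Rn _ cR; have [? ? ?] := Rn _ dR; have [? ? ?] := Rn _ aR; have [? ? ?] := Rn _ bR.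
have : (y == a) || (y == b) by apply: (@LF x c d y z a b) => //; neq.
by rewrite ![y == _]eq_sym; case/orP; apply: contraTT.
Qed.

(** Edges inside [R] contain both [c] and [d], and then are determined by their
    third vertex, or avoid both. *)
Lemma card_inside_pair x y z c d : edge F x y z -> edge F x c d ->
  (forall w, w \in R -> [/\ w != x, w != y & w != z]) ->
  c \in R -> d \in R ->
  #|inside F R| <= #|R| - 2 + #|inside F (R :\: [set c; d])|.
Proof.
move=> xyz xcd Rn cR dR; have [_ _ ncd] := edge_neq gF xcd.
have sub : inside F R \subset [set [set c; d; w] | w in R :\: [set c;
  d]] :|: inside F (R :\: [set c; d]).
  apply/subsetP=> e eD; have /andP[eF eR] : (e \in F) && (e \subset R) by rewrite inE in eD.
  have dce : (c \in e) = (d \in e).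
    have xdc : edge F x d c by tri.
    by apply/idP/idP; [exact: inside_pair xyz xcd Rn cR dR eD|exact: inside_pair xyz xdc Rn dR cR
      eD].
  rewrite inE; have [ce|ce] := boolP (c \in e); apply/orP; [left|right].
    have de : d \in e by rewrite -dce.
    have cde : [set c; d] \subset e by apply/subsetP=> s; rewrite !inE => /orP[]/eqP->.
    have /cards1P[w ew] : #|e :\: [set c; d]| == 1.
      by rewrite cardsD (setIidPr cde) cards2 ncd; have [_ ->] := gF eF.
    have we : w \in e :\: [set c; d] by rewrite ew set11.
    apply/imsetP; exists w; first by apply: (subsetP (setSD _ eR)).
    by rewrite -ew -{1}(setID e [set c; d]) (setIidPr cde).
  rewrite inE eF subsetD eR disjoint_sym disjoints_subset.
  apply/subsetP=> s; rewrite !inE => /orP[] /eqP->; first exact: ce.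
  by rewrite -dce.
apply: leq_trans (subset_leq_card sub) _; apply: leq_trans (leq_card_setU _ _) _.
rewrite leq_add2r (leq_trans (leq_imset_card _ _)) // cardsD (setIidPr _) ?cards2 ?ncd //.
by apply/subsetP=> s; rewrite !inE => /orP[]/eqP->.
Qed.

End AtAnEdge.
End LooseFree.

Section BoundsAtAnEdge.
Variable V : finType.
Implicit Types (F : {set {set V}}) (S R e p q t : {set V}) (x y z w u c d : V).

Definition full_star S s := [set e : {set V} | [&& e \subset S, #|e| == 3 & s \in e]].

(** The bound used in the induction; below 7 vertices counting all triples is
    good enough. *)
Definition loose_bound k := if k < 7 then 'C(k, 3) else 'C(k.-1, 2).

Lemma bin2S n : 'C(n.+1, 2) = n + 'C(n, 2).
Proof. by rewrite binS bin1 addnC. Qed.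

Lemma card_full_star S s : s \in S -> #|full_star S s| = 'C(#|S|.-1, 2).
Proof.
move=> sS; have -> : full_star S s = [set s |: p | p in [set p : {set V} | p \subset S :\ s &
  #|p| == 2]].
  apply/setP=> e; rewrite inE; apply/and3P/imsetP => [[eS /eqP e3 se]|[p]].
    exists (e :\ s); last by rewrite setD1K.
    by rewrite inE setSD // -eqSS -[_.+1]add1n; have := cardsD1 s e; rewrite se e3; lia.
  rewrite inE => /andP[pS /eqP p2] ->.
  have sp : s \notin p by apply/negP=> /(subsetP pS); rewrite !inE eqxx.
  rewrite cardsU1 sp p2 setU11; split => //.
  by rewrite subUset sub1set sS (subset_trans pS) ?subD1set.
rewrite card_in_imset.
  by rewrite cards_draws; congr 'C(_, _); have := cardsD1 s S; rewrite sS; lia.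
have sN p : p \in [set p : {set V} | p \subset S :\ s & #|p| == 2] -> s \notin p.
  by rewrite inE => /andP[/subsetP pS _]; apply/negP=> /pS; rewrite !inE eqxx.
by move=> p q /sN sp /sN sq E; rewrite -(setU1K sp) E setU1K.
Qed.

Lemma in_thirds F R x y w : (w \in thirds F R x y) = (w \in R) && edge F x y w.
Proof. by rewrite inE. Qed.

Lemma card2_le c d : #|[set c; d]| <= 2.
Proof. by rewrite cards2; case: (_ != _). Qed.

Lemma card_sub_pair c d (B : {set V}) : B \subset [set c; d] -> #|B| <= 2.
Proof. by move/subset_leq_card/leq_trans; apply; apply: card2_le. Qed.

Lemma card_sub1 w (B : {set V}) : B \subset [set w] -> #|B| <= 1.
Proof. by move/subset_leq_card; rewrite cards1. Qed.

Lemma loose_free_sub F F' : F' \subset F -> loose_free F -> loose_free F'.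
Proof.
move=> /subsetP FF LF x y z c d a b /FF h1 /FF h2 /FF h3.
exact: (LF x y z c d a b h1 h2 h3).
Qed.

Section AtAnEdge.
Variables (F : {set {set V}}) (S : {set V}) (x y z : V).
Hypothesis gF : graph_on F S.
Hypothesis xyz : edge F x y z.
Let R := S :\: [set x; y; z].

Lemma in_rest w : w \in R -> [/\ w != x, w != y & w != z].
Proof. by rewrite !inE !negb_or => /andP[/andP[/andP[-> ->] ->]]. Qed.

Lemma card_rest : #|S| = #|R| + 3.
Proof.
have [xS yS zS] := edge_in gF xyz; have [_ e3] := gF xyz.
rewrite -(cardsID [set x; y; z] S) (setIidPr _) ?e3 1?addnC //.
by apply/subsetP=> s; rewrite !inE => /orP[/orP[]|] /eqP->.
Qed.

(** Two edges sharing different pairs with [xyz] meet in one vertex of [xyz] unless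
    their third vertices coincide; so either a single pair of [xyz] is extended, in
    at most [#|R|] ways, or each pair is extended at most once. *)
Lemma no_single_meet_bound :
  (forall a b c u v, edge F a b c -> edge F a u v ->
     u != b -> u != c -> v != b -> v != c -> False) ->
  #|F| <= 1 + maxn #|R| 3 + #|inside F R|.
Proof.
move=> tight; have [nxy nxz nyz] := edge_neq gF xyz.
have yxz : edge F y x z by tri.
have zxy : edge F z x y by tri.
have A0 u : u \in [set x; y; z] -> pairs_at F R u = set0.
  move=> uxyz; apply/eqP; rewrite -subset0; apply/subsetP=> p up.
  have uR : u \notin R by rewrite inE uxyz.
  have [c [d [_ /in_rest[? ? ?] /in_rest[? ? ?] _ ucd]]] := pairs_atP gF uR up.
  exfalso; move: uxyz; rewrite !inE => /orP[/orP[]|] /eqP ?; subst u.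
  - exact: (tight x y z c d).
  - exact: (tight y x z c d).
  - exact: (tight z x y c d).
have same a b c u v : edge F a b c -> u \in thirds F R a b -> v \in thirds F R a c ->
    b \notin R -> c \notin R -> b != c -> u = v.
  move=> abc; rewrite !in_thirds => /andP[uR abu] /andP[vR acv] bR cR bc.
  apply/eqP; apply: contraT => uv; exfalso; apply: (tight a b u c v) => //.
  - by rewrite eq_sym.
  - by apply: contraNneq cR => ->.
  - by apply: contraNneq bR => <-.
  - by rewrite eq_sym.
have [xR yR zR] : [/\ x \notin R, y \notin R & z \notin R] by split; rewrite !inE eqxx ?orbT.
have := edge_cover gF xyz; rewrite -/R !A0 ?inE ?eqxx ?orbT // !cards0 !addn0.
have := card_thirds F R x y; have := card_thirds F R x z; have := card_thirds F R y z.
have yz_xz u v : u \in thirds F R y z -> v \in thirds F R x z -> u = v.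
  by rewrite thirdsC [thirds F R x z]thirdsC => hu hv; apply: (same z y x) => //; [tri|neq].
have yz_xy u v : u \in thirds F R y z -> v \in thirds F R x y -> u = v.
  by rewrite [thirds F R x y]thirdsC => hu hv; apply: (same y z x) => //; [tri|neq].
have xz_xy u v : u \in thirds F R x z -> v \in thirds F R x y -> u = v.
  by move=> hu hv; apply: (same x z y) => //; [tri|neq].
have small (B C : {set V}) : (forall u v, u \in B -> v \in C -> u = v) -> #|C| = 0 \/ #|B| <= 1.
  move=> BC; have [->|[v vC]] := set_0Vmem C; first by left; rewrite cards0.
  by right; apply: (card_sub1 (w := v)); apply/subsetP=> u uB; rewrite inE (BC u v).
have := small _ _ yz_xz; have := small _ _ yz_xy; have := small _ _ xz_xy.
have := small _ _ (fun u v hu hv => esym (yz_xz v u hv hu)).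
have := small _ _ (fun u v hu hv => esym (yz_xy v u hv hu)).
have := small _ _ (fun u v hu hv => esym (xz_xy v u hv hu)).
clear; lia.
Qed.

Hypothesis LF : loose_free F.

(** All edges meeting [xyz] in one vertex leave the same pair [cd], so there are at
    most three of them.  By [loose_third], if an edge through two vertices
    of [xyz] has its third vertex [w] outside [cd], the other pairs of [xyz] admit only
    [w], except that [xy] may still be completed by [c] and [d]. *)
Lemma two_centres_bound c d : edge F x c d -> edge F y c d ->
  c \in R -> d \in R -> 3 <= #|R| -> #|F| <= #|R| + 7 + #|inside F R|.
Proof.
move=> xcd ycd cR dR R3; have [nxy nxz nyz] := edge_neq gF xyz.
have [_ _ ncd] := edge_neq gF xcd.
have [? ? ?] := in_rest cR; have [? ? ?] := in_rest dR.
have cdx : [set c; d] \in pairs_at F R x.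
  by rewrite inE setUA -/(edge F x c d) xcd subUset !sub1set cR dR.
have cdy : [set c; d] \in pairs_at F R y.
  by rewrite inE setUA -/(edge F y c d) ycd subUset !sub1set cR dR.
have A1 u : u \in [set x; y; z] -> #|pairs_at F R u| <= 1.
  move=> uxyz; rewrite -(cards1 [set c; d]) subset_leq_card //.
  apply/subsetP=> p up; rewrite inE; apply/eqP.
  move: uxyz; rewrite !inE => /orP[/orP[]|] /eqP ?; subst u.
  - exact: (pairs_at_eq gF LF xyz (@in_rest) up cdy).
  - exact/esym/(pairs_at_eq gF LF xyz (@in_rest) cdx up).
  - have xzy : edge F x z y by tri.
    by apply/esym/(pairs_at_eq gF LF xzy _ cdx up) => w /in_rest[].
have cardB : #|thirds F R y z| + #|thirds F R x z| + #|thirds F R x y| <= #|R| + 3.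
  have := card_thirds F R x y; have := card_thirds F R x z; have := card_thirds F R y z.
  have out (B : {set V}) : B \subset R ->
    #|B| <= 2 \/ exists w, [/\ w \in B, w \in R, w != c & w != d].
    move=> /subsetP BR; have [/card_sub_pair|/subsetPn[w wB]] := boolP (B \subset [set c; d]);
      first by left.
    by rewrite !inE negb_or => /andP[wc wd]; right; exists w; split; rewrite ?BR.
  have thR a b : thirds F R a b \subset R by apply/subsetP=> w; rewrite inE => /andP[].
  have [B3|[w []]] := out _ (thR x y); last first.
    rewrite in_thirds => /andP[_ xyw] wR wc wd; have [? ? ?] := in_rest wR.
    have : #|thirds F R x z| <= 1.
      apply: (card_sub1 (w := w)); apply/subsetP=> u; rewrite in_thirds inE => /andP[uR xzu].
      have [? ? ?] := in_rest uR; apply/eqP.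
      by apply: (loose_third gF LF ycd xyw xzu) => //; neq.
    have : #|thirds F R y z| <= 1.
      apply: (card_sub1 (w := w)); apply/subsetP=> u; rewrite in_thirds inE => /andP[uR yzu].
      have [? ? ?] := in_rest uR; apply/eqP.
      by apply: (loose_third gF LF xcd (_ : edge F y x w) yzu) => //; first [tri|neq].
    clear; lia.
  have [B1|[w []]] := out _ (thR y z); last first.
    rewrite in_thirds => /andP[_ yzw] wR wc wd; have [? ? ?] := in_rest wR.
    have : #|thirds F R x z| <= 1.
      apply: (card_sub1 (w := w)); apply/subsetP=> u; rewrite in_thirds inE => /andP[uR xzu].
      have [? ? ?] := in_rest uR; apply/eqP.
      by apply: (loose_third gF LF ycd (_ : edge F z y w) (_ : edge F z x u)) => //;
        first [tri|neq].
    move: B3; clear; lia.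
  have [B2|[w []]] := out _ (thR x z); last first.
    rewrite in_thirds => /andP[_ xzw] wR wc wd; have [? ? ?] := in_rest wR.
    have : #|thirds F R y z| <= 1.
      apply: (card_sub1 (w := w)); apply/subsetP=> u; rewrite in_thirds inE => /andP[uR yzu].
      have [? ? ?] := in_rest uR; apply/eqP.
      by apply: (loose_third gF LF xcd (_ : edge F z x w) (_ : edge F z y u)) => //;
        first [tri|neq].
    move: B1 B3; clear; lia.
  move: R3 B1 B2 B3; clear; lia.
move: cardB; have := edge_cover gF xyz; rewrite -/R.
have := A1 x; have := A1 y; have := A1 z;
  rewrite !inE !eqxx ?orbT => /(_ isT) + /(_ isT) + /(_ isT).
clear; lia.
Qed.

(** If [yzw] is an edge, [loose_third] leaves only [c], [d] and [w] as third
    vertices of edges through [xy] or [xz]; two choices of [w] leave only [c] and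
    [d].  So such edges either extend [xy] and [xz] only, or are few. *)
Lemma one_centre_bound c d : edge F x c d -> c \in R -> d \in R ->
  pairs_at F R y = set0 -> pairs_at F R z = set0 -> 3 <= #|R| ->
  #|F| <= 1 + (if thirds F R y z == set0 then 2 * #|R| else #|R| + 4)
            + (#|pairs_at F R x| + #|inside F R|).
Proof.
move=> xcd cR dR Ay Az R3; have [nxy nxz nyz] := edge_neq gF xyz.
have [_ _ ncd] := edge_neq gF xcd.
have [? ? ?] := in_rest cR; have [? ? ?] := in_rest dR.
have := edge_cover gF xyz; rewrite -/R Ay Az cards0 !addn0.
have := card_thirds F R x y; have := card_thirds F R x z; have := card_thirds F R y z.
case: eqP => [->|/eqP/set0Pn[w wB]]; first by rewrite cards0; clear; lia.
have near v u : v \in thirds F R y z -> u \in thirds F R x y \/ u \in thirds F R x z ->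
    (u \in [set c; d]) || (u == v).
  rewrite !in_thirds in_set2 => /andP[vR yzv] h; have [? ? ?] := in_rest vR.
  have uR : u \in R by case: h => /andP[].
  have [? ? ?] := in_rest uR; case: (u =P c) => //= /eqP uc; case: (u =P d) => //= /eqP ud.
  rewrite eq_sym; apply/eqP; case: h => /andP[_ xu].
    by apply: (loose_third gF LF xcd (_ : edge F y x u) yzv) => //; first [tri|neq].
  by apply: (loose_third gF LF xcd (_ : edge F z x u) (_ : edge F z y v)) => //; first [tri|neq].
have [Bw|] := boolP (thirds F R y z \subset [set w]).
  have three (B : {set V}) : (forall u, u \in B ->
    u \in thirds F R x y \/ u \in thirds F R x z) -> #|B| <= 3.
    move=> h; have sub : B \subset w |: [set c; d].
      by apply/subsetP=> u /h /(near w u wB) /orP[] E; rewrite in_setU1 E ?orbT.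
    apply: leq_trans (subset_leq_card sub) _.
    by rewrite cardsU1; have := card2_le c d; case: (_ \notin _); clear; lia.
  have := three _ (fun u => @or_introl _ _); have := three _ (fun u => @or_intror _ _).
  by have := card_sub1 Bw; move: R3; clear; lia.
move=> /subsetPn[v vB]; rewrite inE => vw.
have two (B : {set V}) : (forall u, u \in B -> u \in thirds F R x y \/ u \in thirds F R x z) ->
  #|B| <= 2.
  move=> h; apply: (card_sub_pair (c := c) (d := d)); apply/subsetP=> u /h hu.
  have := near w u wB hu; have := near v u vB hu.
  by case: (u \in [set c; d]) => //= /eqP-> /eqP E; rewrite E eqxx in vw.
have := two _ (fun u => @or_introl _ _); have := two _ (fun u => @or_intror _ _).
move: R3; clear; lia.
Qed.

End AtAnEdge.
End BoundsAtAnEdge.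

Section LooseFreeBound.
Variable V : finType.
Implicit Types (F : {set {set V}}) (S R e p q t : {set V}) (x y z w u c d s : V).

Lemma card_pairs_at F S R x : graph_on F S -> x \notin R -> #|pairs_at F R x| <= 'C(#|R|, 2).
Proof.
move=> gF xR; rewrite -cards_draws subset_leq_card //.
apply/subsetP=> p px; have [c [d [-> cR dR cd _]]] := pairs_atP gF xR px.
by rewrite inE cards2 cd subUset !sub1set cR dR.
Qed.

(** By [inside_pair] a pair of the link of [x] lies inside [t] or avoids it. *)
Lemma card_pairs_beside F S R x y z t : graph_on F S -> loose_free F ->
  edge F x y z -> (forall w, w \in R -> [/\ w != x, w != y & w != z]) ->
  t \in inside F R -> #|pairs_at F R x| <= 3 + 'C(#|R| - 3, 2).
Proof.
move=> gF LF xyz Rn tD; have /andP[/gF[_ t3] tR] : (t \in F) && (t \subset R) by rewrite inE in tD.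
have xR : x \notin R by apply/negP=> /Rn[]; rewrite eqxx.
have -> : 3 + 'C(#|R| - 3, 2) = 'C(#|t|, 2) + 'C(#|R :\: t|, 2).
  by rewrite cardsD (setIidPr tR) t3.
rewrite -!cards_draws; apply: leq_trans (leq_card_setU _ _).
apply/subset_leq_card/subsetP=> p px; have [c [d [-> cR dR cd xcd]]] := pairs_atP gF xR px.
have xdc : edge F x d c by tri.
have cdt : (c \in t) = (d \in t).
  by apply/idP/idP; [exact: (inside_pair gF LF xyz xcd Rn cR dR tD)|exact: (inside_pair gF LF xyz
    xdc Rn dR cR tD)].
rewrite !inE cards2 cd !subUset !sub1set !inE cR dR -cdt /=.
by case: (c \in t).
Qed.

(** With [x] added, these pairs become edges of the family induced on [x |: R], which
    has two vertices less than the whole.  For large [R] the induction hypothesis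
    bounds this family; in case of equality it is a full star, whose centre must be
    [x]: a centre [c] would put the path [zyx], [xdc], [cab] into the family.  For
    small [R] a crude count suffices. *)
Lemma link_rest_bound F S R x y z c d :
  graph_on F S -> loose_free F -> edge F x y z ->
  (forall w, w \in R -> [/\ w != x, w != y & w != z]) -> edge F x c d -> c \in R -> d \in R ->
  4 <= #|R| ->
  (7 <= #|R| -> #|inside F (x |: R)| <= 'C(#|R|, 2) /\
     (#|inside F (x |: R)| = 'C(#|R|, 2) ->
       exists2 s, s \in x |: R & inside F (x |: R) = full_star (x |: R) s)) ->
  #|pairs_at F R x| + #|inside F R| <= 'C(#|R|, 2) /\
  (5 <= #|R| -> inside F R != set0 -> #|pairs_at F R x| + #|inside F R| < 'C(#|R|, 2)).
Proof.
move=> gF LF xyz Rn xcd cR dR R4 IH.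
have xR : x \notin R by apply/negP=> /Rn[]; rewrite eqxx.
have [D0|[t tD]] := set_0Vmem (inside F R).
  by rewrite D0 cards0 addn0 eqxx; split => //; apply: card_pairs_at gF xR.
suff : #|pairs_at F R x| + #|inside F R| <= 'C(#|R|, 2) - (5 <= #|R|).
  have : 0 < 'C(#|R|, 2) by rewrite bin_gt0; lia.
  by clear; case: (5 <= #|R|) => ? ?; split=> [|h5 h]; lia.
have [R7|R7] := leqP 7 #|R|.
  have [bd st] := IH R7; have := card_pairs_inside F xR.
  have [E|] := boolP (#|inside F (x |: R)| == 'C(#|R|, 2)); last by move: bd; clear; lia.
  (* Equality: the family on [x |: R] is a full star with some centre [s], and [t]
     shows that [s] is not [x]. *)
  exfalso; have [s sxR sE] := st (eqP E).
  have inst e : (e \in inside F (x |: R)) = [&& e \subset x |: R, #|e| == 3 & s \in e].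
    by rewrite sE inE.
  have xcdR : [set x; c; d] \in inside F (x |: R).
    by rewrite inE -/(edge F x c d) xcd !subUset !sub1set !in_setU1 eqxx cR dR !orbT.
  have tR : t \subset R by move: tD; rewrite inE => /andP[].
  have : t \in inside F (x |: R).
    by move: tD; rewrite !inE => /andP[-> /subset_trans->]; rewrite ?subsetUr.
  rewrite inst => /and3P[_ _ st'].
  have sR := subsetP tR s st'; have [sx sy sz] := Rn s sR.
  have [c' [d' [ncd' xcd' cR' dR' {}st']]] : exists c' d', [/\ c' != d', edge F x c' d', c' \in
    R, d' \in R & s = c'].
    have [_ _ ncd] := edge_neq gF xcd.
    move: xcdR; rewrite inst => /and3P[_ _]; rewrite !inE (negbTE sx) /= => /orP[] /eqP->.
      by exists c, d.
    by exists d, c; split => //; [rewrite eq_sym|tri].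
  subst s.
  have /card_gt1P[a [b [aR bR ab]]] : 1 < #|R :\: [set c'; d']|.
    rewrite cardsD; have := subset_leq_card (subsetIr R [set c'; d']).
    by have := card2_le c' d'; move: R7; clear; lia.
  move: aR bR; rewrite !in_setD !in_set2 !negb_or => /andP[/andP[ac ad] aR] /andP[/andP[bc bd'] bR].
  have : [set c'; a; b] \in inside F R.
    have : [set c'; a; b] \in inside F (x |: R).
      rewrite inst !subUset !sub1set !in_setU1 cR' aR bR !orbT !inE eqxx andbT /=.
      by rewrite card3_uniq /= !inE negb_or ab !(eq_sym c') ac bc.
    by rewrite !inE => /andP[-> _]; rewrite !subUset !sub1set cR' aR bR.
  have := inside_pair gF LF xyz xcd' Rn cR' dR' => /[apply].
  by rewrite !inE eqxx /= eq_sym (negbTE ncd') !(eq_sym d') (negbTE ad) (negbTE bd') => /(_ isT).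
have := card_pairs_beside gF LF xyz Rn tD.
have : #|inside F R| <= #|R| - 2 + 'C(#|R| - 2, 3).
  apply: leq_trans (card_inside_pair gF LF xyz xcd Rn cR dR) _.
  rewrite leq_add2l (_ : #|R| - 2 = #|R :\: [set c; d]|); first by apply: card_le_draws;
    apply: graph_on_inside gF.
  have [_ _ ncd] := edge_neq gF xcd.
  rewrite cardsD (setIidPr _) ?cards2 ?ncd //.
  by apply/subsetP=> s; rewrite !inE => /orP[]/eqP->.
have : (#|R| == 4) || (#|R| == 5) || (#|R| == 6) by move: R4 R7; clear; lia.
move: #|pairs_at F R x| #|inside F R| => a b.
(* For [#|R|] = 4, 5, 6 the two bounds together are 5, 8, 14. *)
have bins : (('C(4 - 3, 2) = 0) * ('C(4 - 2, 3) = 0) * ('C(4, 2) = 6) *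
  ('C(5 - 3, 2) = 1) * ('C(5 - 2, 3) = 1) * ('C(5, 2) = 10) *
  ('C(6 - 3, 2) = 3) * ('C(6 - 2, 3) = 4) * ('C(6, 2) = 15))%type by [].
by case/orP=> [/orP[]|] /eqP ->; rewrite !bins; clear; lia.
Qed.

Lemma loose_bound_large n : loose_bound (n + 7) = 'C(n + 6, 2).
Proof. by rewrite /loose_bound ltnNge leq_addl /= addnS. Qed.

(** The induction step of [loose_free_bound] when the three vertices of an edge
    that no other edge meets in one vertex are deleted. *)
Lemma loose_bound_step3 n : 4 <= n -> maxn n 3 + loose_bound n + 1 < 'C(n.+2, 2).
Proof.
move=> n4; have -> : maxn n 3 = n by lia.
have [n7|n7] := leqP 7 n; last by move: n n4 n7; do 7!case=> //.
rewrite -(subnK n7) loose_bound_large -!addSn !addnS !bin2S.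
by move: 'C(_, 2) => k; lia.
Qed.

(** The same step when the five vertices of two edges meeting in one vertex are
    deleted. *)
Lemma loose_bound_step5 n : 4 <= n -> 2 * n + 5 + loose_bound (n - 2) < 'C(n.+2, 2).
Proof.
move=> n4; have [n9|n9] := leqP 9 n; last by move: n n4 n9; do 9!case=> //.
rewrite -(subnK n9) -addnBA // loose_bound_large !addnS !bin2S.
by rewrite addn0; move: 'C(_, 2) => k; lia.
Qed.

(** Csakany and Kahn proved this bound for families without loose triangle; the
    exclusion of loose paths makes the counting around one edge possible.  The star
    bound satisfies [C(n + 2, 2) = C(n, 2) + 2n + 1] with [n] the number of vertices
    outside the edge, so equality needs [n] further edges through each of [xy] and
    [xz], and no edge that misses [x]. *)
Theorem loose_free_bound F S : graph_on F S -> loose_free F ->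
  #|F| <= loose_bound #|S| /\
  (8 <= #|S| -> #|F| = 'C(#|S|.-1, 2) -> exists2 s, s \in S & F = full_star S s).
Proof.
have [m] := ubnP #|S|; elim: m => // m IH in F S *; rewrite ltnS => Sm gF LF.
have [S7|S7] := ltnP #|S| 7.
  by split; [rewrite /loose_bound S7; apply: card_le_draws|rewrite ltnNge ltnW].
have bdE : loose_bound #|S| = 'C(#|S|.-1, 2) by rewrite /loose_bound ltnNge S7.
rewrite bdE.
suff [bd st] : #|F| <= 'C(#|S|.-1, 2) /\ (8 <= #|S| ->
    (exists2 s, s \in S & F \subset full_star S s) \/ #|F| < 'C(#|S|.-1, 2)).
  split=> // S8 E; have [[s sS sub]|] := st S8; last by rewrite E ltnn.
  by exists s => //; apply/eqP; rewrite eqEcard sub card_full_star // -E leqnn.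
have [->|[e eF]] := set_0Vmem F.
  by rewrite cards0; split => // S8; right; rewrite bin_gt0; move: S8; clear; lia.
have IHR (T : {set V}) : #|T| < #|S| -> #|inside F T| <= loose_bound #|T|.
  move=> TS; have [] // := IH (inside F T) T.
  - exact: leq_trans TS Sm.
  - exact: graph_on_inside gF.
  - by apply: loose_free_sub LF; apply/subsetP=> e'; rewrite inE => /andP[].
pose R x y z := S :\: [set x; y; z].
have Rn x y z w : w \in R x y z -> [/\ w != x, w != y & w != z] by apply: in_rest.
have [/existsP[x /existsP[y /existsP[z /andP[xyz /set0Pn[p px]]]]]|tight] :=
  boolP [exists x, [exists y, [exists z, edge F x y z && (pairs_at F (R x y z) x != set0)]]];
    last first.
  have [x [y [z exyz]]] := card3P (gF _ eF).2.
  have xyz : edge F x y z by rewrite /edge -exyz.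
  suff : #|F| < 'C(#|S|.-1, 2) by move=> lt; split; [exact: ltnW|right].
  have SR := card_rest gF xyz; rewrite -/(R x y z) in SR.
  have R4 : 4 <= #|R x y z| by move: SR S7; clear; lia.
  have := no_single_meet_bound gF xyz; rewrite -/(R x y z) => bd.
  (* No edge is met by another one in a single vertex. *)
  have {}bd : #|F| <= 1 + maxn #|R x y z| 3 + #|inside F (R x y z)|.
    apply: bd => a b c u v abc auv ub uc vb vc; case/negP: tight.
    have [au av _] := edge_neq gF auv; have [_ uS vS] := edge_in gF auv.
    apply/existsP; exists a; apply/existsP; exists b; apply/existsP; exists c.
    rewrite abc; apply/set0Pn; exists [set u; v].
    rewrite inE setUA -/(edge F a u v) auv subUset !sub1set !inE !negb_or.
    by rewrite uS vS ub uc vb vc !(eq_sym _ a) au av.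
  have RS : #|R x y z| < #|S| by rewrite SR; clear; lia.
  have := IHR _ RS; have := loose_bound_step3 R4; rewrite SR addn3 /=.
  by move: bd R4; clear; move: #|inside F (R x y z)| #|F| (loose_bound _); lia.
have xR : x \notin R x y z by apply/negP=> /Rn[]; rewrite eqxx.
have [c [d [_ cR dR ncd xcd]]] := pairs_atP gF xR px.
have SR := card_rest gF xyz; rewrite -/(R x y z) in SR.
have R4 : 4 <= #|R x y z| by move: SR S7; clear; lia.
have R3 : 3 <= #|R x y z| by apply: ltnW.
(* Edges meeting [xyz] in [x] only and edges meeting it in [b] only leave the same
   pair, which is the situation of [two_centres_bound]. *)
have two b q : b \in [set y; z] -> q \in pairs_at F (R x y z) b -> #|F| < 'C(#|S|.-1, 2).
  move=> byz qb.
  have [a [xba Ra]] : exists a, edge F x b a /\ R x b a = R x y z.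
    move: byz; rewrite in_set2 => /orP[] /eqP->; first by exists z.
    by exists y; split; [tri|rewrite /R setUAC].
  rewrite -Ra in cR dR px qb R3 R4 SR.
  have bR : b \notin R x b a by apply/negP=> /Rn[_]; rewrite eqxx.
  have pq := pairs_at_eq gF LF xba (@Rn x b a).
  have cdx : [set c; d] \in pairs_at F (R x b a) x.
    by rewrite inE setUA -/(edge F x c d) xcd subUset !sub1set cR dR.
  have bcd : edge F b c d.
    by have := pq _ _ cdx qb => E; move: qb; rewrite inE -E setUA => /andP[].
  have := two_centres_bound gF xba LF xcd bcd cR dR R3; rewrite -/(R x b a).
  have := card_inside_pair gF LF xba xcd (@Rn x b a) cR dR.
  have Rcd : #|R x b a :\: [set c; d]| = #|R x b a| - 2.
    rewrite cardsD (setIidPr _) ?cards2 ?ncd //.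
    by apply/subsetP=> s; rewrite in_set2 => /orP[]/eqP->.
  have RS : #|R x b a :\: [set c; d]| < #|S| by rewrite SR Rcd; clear; lia.
  have := IHR _ RS; have := loose_bound_step5 R4; rewrite SR Rcd addn3 /=.
  move: R4; clear; lia.
have [Ay|/set0Pn[q qy]] := eqVneq (pairs_at F (R x y z) y) set0; last first.
  have lt : #|F| < 'C(#|S|.-1, 2) by apply: two qy; rewrite !inE eqxx.
  by split; [exact: ltnW|right].
have [Az|/set0Pn[q qz]] := eqVneq (pairs_at F (R x y z) z) set0; last first.
  have lt : #|F| < 'C(#|S|.-1, 2) by apply: two qz; rewrite !inE eqxx orbT.
  by split; [exact: ltnW|right].
have := one_centre_bound gF xyz LF xcd cR dR Ay Az R3; rewrite -/(R x y z) => bd.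
have xRc : #|x |: R x y z| = #|R x y z|.+1 by rewrite cardsU1 xR.
have := link_rest_bound gF LF xyz (@Rn x y z) xcd cR dR R4.
case.
  move=> R7; have [] := IH (inside F (x |: R x y z)) (x |: R x y z).
  - by rewrite xRc; move: SR Sm; clear; lia.
  - exact: graph_on_inside gF.
  - by apply: loose_free_sub LF; apply/subsetP=> e'; rewrite inE => /andP[].
  by rewrite xRc /loose_bound ltnNge (leq_trans R7 (leqnSn _)) /= => ? /(_ R7).
move=> AD ADs.
have binS : 'C(#|S|.-1, 2) = 2 * #|R x y z| + 1 + 'C(#|R x y z|, 2).
  by rewrite SR addn3 /= !bin2S; clear; lia.
split; first by rewrite binS; move: bd AD R4; clear; case: ifP => _; lia.
move=> S8; have R5 : 5 <= #|R x y z| by move: SR S8; clear; lia.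
have {}ADs := ADs R5.
have [D0|/ADs lt] := eqVneq (inside F (R x y z)) set0; last first.
  by right; rewrite binS; move: bd lt R5; clear; case: ifP => _; lia.
case: ifP bd => [/eqP B0 bd|_ bd]; last first.
  by right; rewrite binS; move: bd AD R5; clear; lia.
left; have [xS _ _] := edge_in gF xyz; exists x => //.
apply/subsetP=> e' e'F; have [e'S e'3] := gF _ e'F; rewrite inE e'S e'3 eqxx /=.
have := subsetP (edge_cover_sub gF xyz) e' e'F; rewrite -/(R x y z) B0 D0 Ay Az.
rewrite !imset0 !setU0 !in_setU in_set1 => /orP[/orP[/orP[]|]|].
- by move/eqP->; rewrite !inE eqxx.
- by case/imsetP=> w _ ->; rewrite !inE eqxx.
- by case/imsetP=> w _ ->; rewrite !inE eqxx.
- by case/imsetP=> w _ ->; rewrite !inE eqxx.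
Qed.
End LooseFreeBound.

(** * Path-free families containing a triangle *)

Ltac split_ands := repeat match goal with
  H : is_true (_ && _) |- _ => case/andP: H => ? ? end.
Ltac by_neq := rewrite /= ?inE ?negb_or; repeat (apply/andP; split); first [done | neq].
(** Refutes the context by the loose path on the seven given vertices. *)
Ltac by_path PF x1 x2 x3 x4 x5 x6 x7 :=
  exfalso; apply: (PF x1 x2 x3 x4 x5 x6 x7); [by_neq | tri | tri | tri].

Section Triangles.
Variable V : finType.
Implicit Types (F : {set {set V}}) (S R U p q t g : {set V}) (a b c d e f u v w x y z : V).

Definition path_free F := forall x1 x2 x3 x4 x5 x6 x7 : V,
  uniq [:: x1; x2; x3; x4; x5; x6; x7] ->
  edge F x1 x2 x3 -> edge F x3 x4 x5 -> edge F x5 x6 x7 -> False.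

Definition triangle F a b c d e f :=
  [&& uniq [:: a; b; c; d; e; f], edge F a b c, edge F c d e & edge F e f a].

Lemma loose_free_or_triangle F S : graph_on F S -> path_free F ->
  (forall a b c d e f, ~~ triangle F a b c d e f) -> loose_free F.
Proof.
move=> gF PF TF x y z c d a b xcd xyz yab cy cz dy dz ax az bx bz.
have [xc xd cd] := edge_neq gF xcd; have [xy xz yz] := edge_neq gF xyz.
have [ya yb ab] := edge_neq gF yab.
apply: contraT; rewrite negb_or => /andP[ca cb].
have [da|da] := eqVneq d a.
  subst d; case/negP: (TF x c a b y z); apply/and4P; split; [by_neq|tri|tri|tri].
have [db|db] := eqVneq d b.
  subst d; case/negP: (TF x c b a y z); apply/and4P; split; [by_neq|tri|tri|tri].
by_path PF c d x z y a b.
Qed.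

(** An explicit list of the subsets of size [k], so that counting the edges inside a
    concrete vertex list unfolds to a sum of booleans. *)
Fixpoint ksubsets (k : nat) (s : seq V) : seq {set V} :=
  match k, s with
  | 0, _ => [:: set0]
  | _, [::] => [::]
  | k'.+1, x :: s' => [seq x |: p | p <- ksubsets k' s'] ++ ksubsets k s'
  end.

Lemma mem_ksubsets k s p : p \subset [set x in s] -> #|p| = k -> p \in ksubsets k s.
Proof.
elim: s k p => [|x s IH] k p ps pk.
  have p0 : p = set0 by apply/eqP; rewrite -subset0; apply: subset_trans ps _; apply/subsetP=> x;
    rewrite inE.
  by case: k pk => [|k]; rewrite p0 ?cards0 ?inE.
case: k pk => [/eqP|k pk]; first by rewrite cards_eq0 => /eqP->; rewrite /= inE.
rewrite /= mem_cat; have [xp|xp] := boolP (x \in p); apply/orP; [left|right].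
  apply/mapP; exists (p :\ x); last by rewrite setD1K.
  apply: IH; last by have := cardsD1 x p; rewrite xp pk add1n => -[].
  apply/subsetP=> y; rewrite !inE => /andP[yx yp].
  by have := subsetP ps y yp; rewrite !inE (negbTE yx).
apply: IH => //; apply/subsetP=> y yp; have := subsetP ps y yp; rewrite !inE.
by case: eqP => // yx; rewrite -yx yp in xp.
Qed.

Lemma card_inside_seq F S s : graph_on F S ->
  #|inside F [set x in s]| <= count (fun p => p \in F) (ksubsets 3 s).
Proof.
move=> gF; rewrite -size_filter; apply: leq_trans (card_size _).
apply/subset_leq_card/subsetP=> e; rewrite inE => /andP[eF es].
by rewrite mem_filter eF mem_ksubsets //; have [] := gF _ eF.
Qed.

Section OneTriangle.
Variables (F : {set {set V}}) (S : {set V}).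
Hypothesis gF : graph_on F S.
Hypothesis PF : path_free F.

(** Together with [triangle_rev] this generates the symmetries of the triangle, so
    that each of the following facts needs one representative only. *)
Lemma triangle_rot a b c d e f : triangle F a b c d e f -> triangle F c d e f a b.
Proof.
case/and4P=> un abc cde efa; apply/and4P; split => //; rewrite /= ?inE ?negb_or in un *; split_ands.
by repeat (apply/andP; split); first [done | neq].
Qed.

Lemma triangle_rev a b c d e f : triangle F a b c d e f -> triangle F c b a f e d.
Proof.
case/and4P=> un abc cde efa; apply/and4P; split; try tri; rewrite /= ?inE ?negb_or in un *;
  split_ands.
by repeat (apply/andP; split); first [done | neq].
Qed.

Ltac open_triangle T := move: T; rewrite /triangle /= ?inE ?negb_or => T; split_ands.

Lemma no_single_corner a b c d e f u v : triangle F a b c d e f ->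
  u \notin [:: a; b; c; d; e; f] -> v \notin [:: a; b; c; d; e; f] -> ~~ edge F a u v.
Proof.
move=> T uo vo; apply/negP=> auv; have [_ _ uv] := edge_neq gF auv.
open_triangle T. rewrite ?inE ?negb_or in uo vo. split_ands.
by_path PF u v a b c d e.
Qed.

Lemma no_single_middle a b c d e f u v : triangle F a b c d e f ->
  u \notin [:: a; b; c; d; e; f] -> v \notin [:: a; b; c; d; e; f] -> ~~ edge F b u v.
Proof.
move=> T uo vo; apply/negP=> buv; have [_ _ uv] := edge_neq gF buv.
open_triangle T. rewrite ?inE ?negb_or in uo vo. split_ands.
by_path PF u v b a c d e.
Qed.

Lemma no_side a b c d e f v : triangle F a b c d e f ->
  v \notin [:: a; b; c; d; e; f] -> ~~ edge F a b v.
Proof.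
move=> T vo; apply/negP=> abv; open_triangle T. rewrite ?inE ?negb_or in vo. split_ands.
by_path PF v b a f e d c.
Qed.

Lemma no_middles a b c d e f v : triangle F a b c d e f ->
  v \notin [:: a; b; c; d; e; f] -> ~~ edge F b d v.
Proof.
move=> T vo; apply/negP=> bdv; open_triangle T. rewrite ?inE ?negb_or in vo. split_ands.
by_path PF v d b c a f e.
Qed.

Lemma corner_pair_far a b c d e f v w z : triangle F a b c d e f ->
  v \notin [:: a; b; c; d; e; f] -> w \notin [:: a; b; c; d; e; f] ->
  z \notin [:: a; b; c; d; e; f] -> edge F a c v -> ~~ edge F v w z.
Proof.
move=> T vo wo zo acv; apply/negP=> vwz; have [vw vz wz] := edge_neq gF vwz.
open_triangle T. rewrite ?inE ?negb_or in vo wo zo. split_ands.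
by_path PF w z v c a f e.
Qed.

Lemma diagonal_far a b c d e f v w z : triangle F a b c d e f ->
  v \notin [:: a; b; c; d; e; f] -> w \notin [:: a; b; c; d; e; f] ->
  z \notin [:: a; b; c; d; e; f] -> edge F a d v -> ~~ edge F v w z.
Proof.
move=> T vo wo zo acv; apply/negP=> vwz; have [vw vz wz] := edge_neq gF vwz.
open_triangle T. rewrite ?inE ?negb_or in vo wo zo. split_ands.
by_path PF w z v d a b c.
Qed.

Lemma not_both (b1 b2 : bool) : (b1 -> b2 -> False) -> b1 + b2 <= 1.
Proof. by case: b1 b2 => -[] // /(_ isT isT). Qed.

(** The pairs [ac] and [eb] are disjoint, and the edge [cde] of the triangle
    meets both in one vertex. *)
Lemma corner_diagonal a b c d e f v w : triangle F a b c d e f ->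
  v \notin [:: a; b; c; d; e; f] -> w \notin [:: a; b; c; d; e; f] -> v != w ->
  edge F a c v + edge F e b w <= 1.
Proof.
move=> T vo wo vw; apply: not_both => acv ebw.
open_triangle T. rewrite ?inE ?negb_or in vo wo. split_ands.
by_path PF v a c d e b w.
Qed.

(** Five triples inside the triangle form a path with [acv] and one edge of the
    triangle.  Four further pairs of complementary triples, one through [a] and the
    other through [c], form a path around [acv], so each pair loses a triple. *)
Lemma inside_corner_pair a b c d e f v : triangle F a b c d e f ->
  v \notin [:: a; b; c; d; e; f] -> edge F a c v ->
  #|inside F [set x in [:: a; b; c; d; e; f]]| <= 11.
Proof.
move=> T vo acv; apply: leq_trans (card_inside_seq _ gF) _.
open_triangle T. rewrite ?inE ?negb_or in vo. split_ands.
rewrite /= !setU0 !setUA -!/(edge F _ _ _).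
have k1 : edge F a b f = false by apply/negP=> ?; by_path PF b f a v c d e.
have k2 : edge F b c d = false by apply/negP=> ?; by_path PF b d c v a e f.
have k3 : edge F b d f = false by apply/negP=> ?; by_path PF v c a e f b d.
have k4 : edge F b d e = false by apply/negP=> ?; by_path PF v c a f e b d.
have k5 : edge F b e f = false by apply/negP=> ?; by_path PF v a c d e b f.
have p1 : edge F a b d + edge F c e f <= 1 by apply: not_both=> ? ?; by_path PF b d a v c e f.
have p2 : edge F a b e + edge F c d f <= 1 by apply: not_both=> ? ?; by_path PF b e a v c d f.
have p3 : edge F a d e + edge F b c f <= 1 by apply: not_both=> ? ?; by_path PF d e a v c b f.
have p4 : edge F a d f + edge F b c e <= 1 by apply: not_both=> ? ?; by_path PF d f a v c b e.
rewrite k1 k2 k3 k4 k5; move: p1 p2 p3 p4.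
have [E E1 EE] : exists2 E : V -> V -> V -> nat, forall x y z, E x y z <= 1 &
    forall x y z, nat_of_bool (edge F x y z) = E x y z.
  by exists (fun x y z => edge F x y z) => // x y z; apply: leq_b1.
rewrite !EE; have := E1 a b c; have := E1 a c d; have := E1 a c f; have := E1 a e f.
have := E1 a c e; have := E1 c d e; have := E1 d e f; clear; lia.
Qed.

(** As for a corner pair; here seven triples are excluded outright and two pairs of
    complementary triples conflict. *)
Lemma inside_diagonal a b c d e f v : triangle F a b c d e f ->
  v \notin [:: a; b; c; d; e; f] -> edge F a d v ->
  #|inside F [set x in [:: a; b; c; d; e; f]]| <= 11.
Proof.
move=> T vo adv; apply: leq_trans (card_inside_seq _ gF) _.
open_triangle T. rewrite ?inE ?negb_or in vo. split_ands.
rewrite /= !setU0 !setUA -!/(edge F _ _ _).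
have k1 : edge F a b f = false by apply/negP=> ?; by_path PF b f a v d c e.
have k2 : edge F b c d = false by apply/negP=> ?; by_path PF b c d v a e f.
have k3 : edge F d e f = false by apply/negP=> ?; by_path PF b c a v d e f.
have k4 : edge F b c e = false by apply/negP=> ?; by_path PF v d a f e b c.
have k5 : edge F b c f = false by apply/negP=> ?; by_path PF v d a e f b c.
have k6 : edge F b e f = false by apply/negP=> ?; by_path PF v d a c b e f.
have k7 : edge F c e f = false by apply/negP=> ?; by_path PF v d a b c e f.
have p1 : edge F a b e + edge F c d f <= 1 by apply: not_both=> ? ?; by_path PF b e a v d c f.
have p2 : edge F a c e + edge F b d f <= 1 by apply: not_both=> ? ?; by_path PF c e a v d b f.
rewrite k1 k2 k3 k4 k5 k6 k7; move: p1 p2.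
have [E E1 EE] : exists2 E : V -> V -> V -> nat, forall x y z, E x y z <= 1 &
    forall x y z, nat_of_bool (edge F x y z) = E x y z.
  by exists (fun x y z => edge F x y z) => // x y z; apply: leq_b1.
rewrite !EE; have := E1 a b c; have := E1 a b d; have := E1 a c d; have := E1 a c f.
have := E1 a d e; have := E1 a d f; have := E1 a e f; have := E1 b d e; have := E1 c d e.
clear; lia.
Qed.

End OneTriangle.
End Triangles.

(** * The Turan number of the loose path *)

Section Turan.
Variable V : finType.
Implicit Types (F : {set {set V}}) (S R U X p q t g : {set V}) (a b c d e f u v w x y z : V).

(** The Turan number of the loose path: complete 3-graphs up to 6 vertices, a
    complete 3-graph and an isolated vertex for 7, full stars from 8 on. *)
Definition turan k := if k <= 6 then 'C(k, 3) else if k == 7 then 20 else 'C(k.-1, 2).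

Lemma turan_large n : turan (n + 8) = 'C(n + 7, 2).
Proof. by rewrite /turan !addnS. Qed.

Lemma bin2D m n : 'C(m + n, 2) = 'C(m, 2) + 'C(n, 2) + m * n.
Proof. by elim: m => [|m IH]; rewrite ?add0n ?addn0 // addSn !bin2S IH mulSn; lia. Qed.

Lemma turan_superadditive m n : turan m + turan n <= turan (m + n).
Proof.
wlog mn : m n / m <= n => [H|].
  by case: (leqP m n) => [|/ltnW] /H //; rewrite addnC [n + m]addnC.
have [n8|n8] := leqP 8 n.
  rewrite -(subnK n8) addnA !turan_large; move: (n - 8) => k.
  have [m8|m8] := leqP 8 m.
    rewrite -(subnK m8) turan_large; move: (m - 8) => l.
    rewrite (_ : l + 8 + k + 7 = (l + 7 + (k + 7)).+1); last by lia.
    by rewrite bin2S (bin2D (l + 7)); lia.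
  rewrite -addnA (bin2D m).
  have : turan m <= 7 * m by move: m m8 {mn}; do 8!case=> //.
  nia.
have small : all (fun i => all (fun j =>
  turan i + turan j <= turan (i + j)) (iota 0 8)) (iota 0 8) by [].
by apply: (allP (allP small m _)); rewrite mem_iota //= (leq_ltn_trans mn).
Qed.

(** The left-hand side bounds the number of edges meeting a triangle when [t]
    outer vertices are attached to it; attaching them is worse than a complete
    3-graph on the six vertices beside an extremal one on the [t] others. *)
Lemma turan_exceeds_attached (t : nat) : 0 < t -> 11 + 3 * t + 3 * (t == 1) < 20 + turan t.
Proof.
have [t8|t8] := leqP 8 t; last by move: t t8; do 8!case=> //.
rewrite -(subnK t8) turan_large; move: (t - 8) => l _.
have -> : (l + 8 == 1) = false by lia.
by rewrite bin2D (_ : 'C(7, 2) = 21) //; lia.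
Qed.

(** At most one value exceeds 3, and it is compensated by any other one. *)
Lemma sum_pairwise (X : {set V}) (l : V -> nat) : (forall v, l v <= 6) ->
  {in X &, forall v w, v != w -> l v + l w <= 6} ->
  \sum_(v in X) l v <= 3 * #|X| + 3 * (#|X| == 1).
Proof.
move=> l6 lp; have [small|] := boolP [forall v in X, l v <= 3].
  apply: leq_trans (leq_addr _ _); rewrite mulnC -sum_nat_const.
  by apply: leq_sum => v vX; apply: (forall_inP small).
rewrite negb_forall_in => /existsP[v /andP[vX]]; rewrite -ltnNge => lv.
rewrite (big_setD1 v) //= (cardsD1 v X) vX /=.
have : \sum_(w in X :\ v) l w <= #|X :\ v| * (6 - l v).
  rewrite -sum_nat_const; apply: leq_sum => w; rewrite !inE => /andP[wv wX].
  by have := lp w v wX vX wv; lia.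
move: (\sum_(w in X :\ v) l w) #|X :\ v| (l6 v) lv; clear => a n.
case: n => [|n]; [lia|nia].
Qed.

(** The pairs of vertices of a triangle that can lie on an edge with a third vertex
    outside: pairs of corners, and a corner with the opposite middle vertex. *)
Definition hub_pairs a b c d e f := [:: (a, c); (c, e); (e, a); (a, d); (c, f); (e, b)].

Section OneTriangle.
Variables (F : {set {set V}}) (S : {set V}) (a b c d e f : V).
Hypothesis gF : graph_on F S.
Hypothesis PF : path_free F.
Hypothesis T : triangle F a b c d e f.
Let s := [:: a; b; c; d; e; f].
Let U := [set x in s].
Let hubs v := count (fun r => edge F r.1 r.2 v) (hub_pairs a b c d e f).
Let X := [set v in S :\: U | 0 < hubs v].

Let Tc : triangle F c d e f a b := triangle_rot T.
Let Te : triangle F e f a b c d := triangle_rot Tc.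

Lemma mem_rot2 v : (v \in [:: c; d; e; f; a; b]) = (v \in s).
Proof. by rewrite (mem_rot 2 s). Qed.

Lemma mem_rot4 v : (v \in [:: e; f; a; b; c; d]) = (v \in s).
Proof. by rewrite (mem_rot 4 s). Qed.

Lemma mem_rev6 v : (v \in [:: c; b; a; f; e; d]) = (v \in s).
Proof. by rewrite -(mem_rev s) -(mem_rot 3 (rev s)). Qed.

(** The six hub pairs form three couples of disjoint pairs, [ac] with [eb], [ce] with
    [ad] and [ea] with [cf]; by [corner_diagonal] a pair used by [v] bars its partner
    from [w]. *)
Lemma hubs_pair v w : v \notin s -> w \notin s -> v != w -> hubs v + hubs w <= 6.
Proof.
move=> vs ws vw; have wv : w != v by rewrite eq_sym.
have := corner_diagonal PF T vs ws vw; have := corner_diagonal PF T ws vs wv.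
have cd1 v' w' : v' \notin s -> w' \notin s -> v' != w' -> edge F c e v' + edge F a d w' <= 1.
  by move=> h1 h2; apply: (corner_diagonal PF Tc); rewrite mem_rot2.
have cd2 v' w' : v' \notin s -> w' \notin s -> v' != w' -> edge F e a v' + edge F c f w' <= 1.
  by move=> h1 h2; apply: (corner_diagonal PF Te); rewrite mem_rot4.
have := cd1 v w vs ws vw; have := cd1 w v ws vs wv.
have := cd2 v w vs ws vw; have := cd2 w v ws vs wv.
rewrite /hubs /=; clear.
have [E EE] : exists E : V -> V -> V -> nat, forall x y z, nat_of_bool (edge F x y z) = E x y z.
  by exists (fun x y z => edge F x y z).
by rewrite !EE; clear; lia.
Qed.

Lemma hubs_cases v : 0 < hubs v -> exists r, r \in hub_pairs a b c d e f /\ edge F r.1 r.2 v.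
Proof. by rewrite -has_count => /hasP[r rs rv]; exists r. Qed.

Lemma inside_hub v : v \notin s -> 0 < hubs v -> #|inside F U| <= 11.
Proof.
move=> vs /hubs_cases[r []].
have Uc : U = [set x in [:: c; d; e; f; a; b]] by apply/setP=> x; rewrite !in_set mem_rot2.
have Ue : U = [set x in [:: e; f; a; b; c; d]] by apply/setP=> x; rewrite !in_set mem_rot4.
rewrite 6!in_cons =>
  /orP[/eqP->|/orP[/eqP->|/orP[/eqP->|/orP[/eqP->|/orP[/eqP->|/orP[/eqP->|//]]]]]] /=.
- exact: (inside_corner_pair gF PF T vs).
- by rewrite Uc; apply: (inside_corner_pair gF PF Tc); rewrite mem_rot2.
- by rewrite Ue; apply: (inside_corner_pair gF PF Te); rewrite mem_rot4.
- exact: (inside_diagonal gF PF T vs).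
- by rewrite Uc; apply: (inside_diagonal gF PF Tc); rewrite mem_rot2.
- by rewrite Ue; apply: (inside_diagonal gF PF Te); rewrite mem_rot4.
Qed.

Lemma hub_far v w z : v \notin s -> w \notin s -> z \notin s -> 0 < hubs v -> ~~ edge F v w z.
Proof.
move=> vs ws zs /hubs_cases[r []].
rewrite 6!in_cons =>
  /orP[/eqP->|/orP[/eqP->|/orP[/eqP->|/orP[/eqP->|/orP[/eqP->|/orP[/eqP->|//]]]]]] /=.
- exact: (corner_pair_far gF PF T).
- by apply: (corner_pair_far gF PF Tc); rewrite mem_rot2.
- by apply: (corner_pair_far gF PF Te); rewrite mem_rot4.
- exact: (diagonal_far gF PF T).
- by apply: (diagonal_far gF PF Tc); rewrite mem_rot2.
- by apply: (diagonal_far gF PF Te); rewrite mem_rot4.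
Qed.

Lemma no_single u v w : u \in s -> v \notin s -> w \notin s -> ~~ edge F u v w.
Proof.
move=> + vs ws.
have [vc wc] : v \notin [:: c; d; e; f; a; b] /\ w \notin [:: c; d; e; f; a;
  b] by rewrite !mem_rot2.
have [ve we] : v \notin [:: e; f; a; b; c; d] /\ w \notin [:: e; f; a; b; c;
  d] by rewrite !mem_rot4.
rewrite 6!in_cons =>
  /orP[/eqP->|/orP[/eqP->|/orP[/eqP->|/orP[/eqP->|/orP[/eqP->|/orP[/eqP->|//]]]]]].
- exact: (no_single_corner gF PF T vs ws).
- exact: (no_single_middle gF PF T vs ws).
- exact: (no_single_corner gF PF Tc vc wc).
- exact: (no_single_middle gF PF Tc vc wc).
- exact: (no_single_corner gF PF Te ve we).
- exact: (no_single_middle gF PF Te ve we).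
Qed.

Lemma double_hub u v w : u \in s -> v \in s -> w \notin s -> edge F u v w ->
  [set u; v] \in [seq [set r.1; r.2] | r <- hub_pairs a b c d e f & edge F r.1 r.2 w].
Proof.
move=> us vs ws uvw; have [uv _ _] := edge_neq gF uvw.
have wc : w \notin [:: c; d; e; f; a; b] by rewrite mem_rot2.
have we : w \notin [:: e; f; a; b; c; d] by rewrite mem_rot4.
have n1 := no_side PF T ws.
have n2 := no_side PF Tc wc.
have n3 := no_side PF Te we.
have n4 := no_middles PF T ws.
have n5 := no_middles PF Tc wc.
have n6 := no_middles PF Te we.
have wr : w \notin [:: c; b; a; f; e; d] by rewrite mem_rev6.
have wrc : w \notin [:: e; d; c; b; a; f].
  by rewrite -(mem_rot 4 [:: c; b; a; f; e; d]) in wr.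
have wre : w \notin [:: a; f; e; d; c; b].
  by rewrite -(mem_rot 2 [:: c; b; a; f; e; d]) in wr.
have n7 := no_side PF (triangle_rev T) wr.
have n8 := no_side PF (triangle_rev Tc) wrc.
have n9 := no_side PF (triangle_rev Te) wre.
have pick (r : V * V) : r \in hub_pairs a b c d e f -> edge F r.1 r.2 w -> 
    [set r.1; r.2] \in [seq [set r.1; r.2] | r <- hub_pairs a b c d e f & edge F r.1 r.2 w].
  by move=> rh rw; apply/mapP; exists r; rewrite // mem_filter rw rh.
have swap (r : V * V) : r \in hub_pairs a b c d e f -> edge F r.2 r.1 w -> 
    [set r.2; r.1] \in [seq [set r.1; r.2] | r <- hub_pairs a b c d e f & edge F r.1 r.2 w].
  by rewrite setUC edgeC; apply: pick.
rewrite 6!in_cons in us; rewrite 6!in_cons in vs.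
case/orP: us => [/eqP E|/orP[/eqP E|/orP[/eqP E|/orP[/eqP E|/orP[/eqP E|/orP[/eqP E|//]]]]]];
  rewrite {}E in uv uvw *;
case/orP: vs => [/eqP E|/orP[/eqP E|/orP[/eqP E|/orP[/eqP E|/orP[/eqP E|/orP[/eqP E|//]]]]]];
  rewrite {}E in uv uvw *;
first [ by rewrite eqxx in uv
      | exfalso; match goal with H : is_true (~~ edge F ?x ?y w) |- _ => by case/negP: H; tri end
      | by (apply: (pick (_, _)) => //; rewrite !inE eqxx ?orbT)
      | by (apply: (swap (_, _)) => //; rewrite !inE eqxx ?orbT) ].
Qed.

(** Indexed by outer vertex and hub pair, so that its size is bounded by the
    sum of the numbers [hubs v]. *)
Definition mixed := \bigcup_(v in X)
  [set g in [seq [set r.1; r.2; v] | r <- hub_pairs a b c d e f & edge F r.1 r.2 v]].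

Lemma triangle_cover : F \subset inside F U :|: mixed :|: inside F (S :\: U :\: X).
Proof.
apply/subsetP=> g gF'; have [gS g3] := gF gF'.
have [x [y [z gE]]] := card3P g3.
have two u v w : u \in s -> v \in s -> w \notin s -> edge F u v w -> [set u; v; w] \in mixed.
  move=> us vs ws uvw; have [_ _ wS] := edge_in gF uvw.
  have /mapP[r] := double_hub us vs ws uvw; rewrite mem_filter => /andP[rw rh] ->.
  apply/bigcupP; exists w; last by rewrite inE; apply/mapP; exists r; rewrite // mem_filter rw.
  by rewrite !in_set -/s ws wS /= -has_count; apply/hasP; exists r.
have xyz : edge F x y z by rewrite /edge -gE.
rewrite !in_setU; have [xs|xs] := boolP (x \in s); have [ys|ys] := boolP (y \in s);
  have [zs|zs] := boolP (z \in s).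
- by rewrite inE gF' gE !subUset !sub1set !in_set -/s xs ys zs.
- by rewrite gE two ?orbT.
- by rewrite gE setUAC two ?orbT //; tri.
- by have := no_single xs ys zs; rewrite xyz.
- by rewrite gE -setUA setUC two ?orbT //; tri.
- by have := no_single ys xs zs; case/negP; tri.
- by have := no_single zs xs ys; case/negP; tri.
- apply/orP; right; rewrite inE gF'; apply/subsetP=> u ug;
  rewrite in_setD in_setD (subsetP gS) // andbT [u \in U]in_set.
  have us : u \notin s by move: ug; rewrite gE !in_setU !in_set1 => /orP[/orP[]|] /eqP->.
  rewrite us andbT in_set negb_and -leqNgt; apply/orP; right.
  rewrite leqNgt; apply/negP=> hu.
  move: ug; rewrite gE !in_setU !in_set1 => /orP[/orP[]|] /eqP E; subst u.
  + by have := hub_far us ys zs hu; rewrite xyz.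
  + by have := hub_far us xs zs hu; case/negP; tri.
  + by have := hub_far us xs ys hu; case/negP; tri.
Qed.

Lemma card_mixed : #|mixed| <= \sum_(v in X) hubs v.
Proof.
rewrite /mixed; elim/big_ind2: _ => [|g1 n1 g2 n2 h1 h2|v _]; first by rewrite cards0.
  exact: leq_trans (leq_card_setU _ _) (leq_add h1 h2).
by rewrite cardsE; apply: leq_trans (card_size _) _; rewrite size_map size_filter.
Qed.

Lemma card_six : #|U| = 6.
Proof. by case/and4P: T => un _ _ _; rewrite cardsE (card_uniqP un). Qed.

Lemma six_sub : U \subset S.
Proof.
case/and4P: T => un abc cde efa; apply/subsetP=> x; rewrite in_set.
have [? ? ?] := edge_in gF abc; have [? ? ?] := edge_in gF cde; have [? ? ?] := edge_in gF efa.
by rewrite 6!in_cons =>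
  /orP[/eqP->|/orP[/eqP->|/orP[/eqP->|/orP[/eqP->|/orP[/eqP->|/orP[/eqP->|//]]]]]].
Qed.

Lemma triangle_dichotomy :
  (forall R, R \subset S :\: U -> #|inside F R| <= turan #|R|) ->
  #|F| < 20 + turan (#|S| - 6) \/ F = inside F U :|: inside F (S :\: U).
Proof.
move=> IH; have [X0|[v vX]] := set_0Vmem X.
  right; apply/eqP; rewrite eqEsubset; apply/andP; split.
    by have := triangle_cover; rewrite /mixed X0 big_set0 setU0 setD0.
  by apply/subsetP=> g; rewrite !inE => /orP[] /andP[].
left; have := subset_leq_card triangle_cover.
have cX : 0 < #|X| by apply/card_gt0P; exists v.
have XsubU : X \subset S :\: U by apply/subsetP=> w; rewrite in_set => /andP[].
have Xs w : w \in X -> w \notin s /\ 0 < hubs w by rewrite !in_set -/s => /andP[/andP[? _]].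
have := turan_exceeds_attached cX; have := turan_superadditive #|X| #|S :\: U :\: X|.
have -> : #|X| + #|S :\: U :\: X| = #|S| - 6.
  by rewrite -{1}(setIidPr XsubU) cardsID cardsD (setIidPr six_sub) card_six.
have := IH (S :\: U :\: X) (subsetDl _ _); have [vs hv] := Xs v vX; have := inside_hub vs hv.
have : \sum_(v in X) hubs v <= 3 * #|X| + 3 * (#|X| == 1).
  apply: sum_pairwise; first by move=> w; apply: leq_trans (count_size _ _) _.
  by move=> w w' /Xs[? _] /Xs[? _]; apply: hubs_pair.
have := card_mixed.
have := (leq_card_setU (inside F U :|: mixed) (inside F (S :\: U :\: X))).1.
have := (leq_card_setU (inside F U) mixed).1.
move: #|inside F U| #|mixed| #|inside F (S :\: U :\: X)| #|_ :|: _| #|_ :|: _| #|F| =>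
  n1 n2 n3 n4 n5 n6.
move: (#|X| == 1) (\sum_(v in X) _) => b1 m1.
move: (turan _) => t1; move: (turan _) => t2; move: (turan _) => t3.
by move: #|X|; clear; lia.
Qed.
End OneTriangle.

Lemma path_free_sub F F' : F' \subset F -> path_free F -> path_free F'.
Proof.
move=> /subsetP FF PF x1 x2 x3 x4 x5 x6 x7 un /FF h1 /FF h2 /FF h3.
exact: (PF x1 x2 x3 x4 x5 x6 x7).
Qed.

(** Whether a triple is an edge of the extremal family on [m] vertices, [hit] telling
    whether it contains the apex: every triple for [m <= 6], the triples avoiding the
    isolated vertex for [m = 7], and those through the centre from 8 on. *)
Definition turan_rule m (hit : bool) := if m <= 6 then true else if m == 7 then ~~ hit else hit.

Definition turan_edges S A :=
  [set g : {set V} | [&& g \subset S, #|g| == 3 & turan_rule #|S| (A :&: g != set0)]].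

Definition extremal F S := exists A : {set V},
  [/\ A \subset S, #|A| = (7 <= #|S|) & F = turan_edges S A].

Lemma sub_draws_eq F S : graph_on F S -> #|F| = 'C(#|S|, 3) ->
  F = [set g : {set V} | g \subset S & #|g| == 3].
Proof.
move=> gF cF; apply/eqP; rewrite eqEcard cards_draws cF leqnn andbT.
by apply/subsetP=> g /gF[gS g3]; rewrite inE gS g3 eqxx.
Qed.

Lemma turan_step k : 20 + turan (k + 2) < turan (k + 8).
Proof.
rewrite turan_large; have [k6|k6] := leqP 6 k; last by move: k k6; do 6!case=> //.
rewrite -(subnK k6) -addnA turan_large; move: (k - 6) => n.
rewrite (_ : n + 6 + 7 = n + 7 + 6) ?bin2D; last by lia.
by rewrite (_ : 'C(6, 2) = 15) //; lia.
Qed.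

(** From 8 vertices on, [turan_step] keeps a family with a triangle below the bound,
    and otherwise the star is optimal by [loose_free_bound].  On 7 vertices
    the order is reversed: the triangle case gives 20 and the star only 15. *)
Theorem turan_path F S : graph_on F S -> path_free F ->
  #|F| <= turan #|S| /\ (#|F| = turan #|S| -> extremal F S).
Proof.
have [m] := ubnP #|S|; elim: m => // m IH in F S *; rewrite ltnS => Sm gF PF.
have [S6|S7] := leqP #|S| 6.
  rewrite /turan S6; split; first exact: card_le_draws.
  move/(sub_draws_eq gF) => ->; exists set0; rewrite sub0set cards0 ltnNge S6; split=> //.
  by apply/setP=> g; rewrite !inE /turan_rule S6 andbT.
have [/existsP[a /existsP[b /existsP[c /existsP[d /existsP[e /existsP[f T]]]]]]|noT] :=
  boolP [exists a, [exists b, [exists c, [exists d, [exists e, [exists f, triangle F a b c d e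
    f]]]]]].
  have U6 := card_six T; have US := six_sub gF T; set U := [set x in _] in U6 US.
  have IHR R : R \subset S :\: U -> #|inside F R| <= turan #|R|.
    move=> RS; have [] // := IH (inside F R) R.
    - apply: leq_ltn_trans (subset_leq_card RS) _; rewrite cardsD (setIidPr US) U6.
      by move: Sm S7; clear; lia.
    - exact: graph_on_inside gF.
    - by apply: path_free_sub PF; apply/subsetP=> g; rewrite inE => /andP[].
  have FU : #|inside F U| <= 20.
    by apply: leq_trans (card_le_draws (graph_on_inside gF)) _; rewrite U6.
  have FR := IHR _ (subxx _); rewrite cardsD (setIidPr US) U6 in FR.
  have [S7'|S8] := eqVneq #|S| 7.
    rewrite S7' /=; have [|FE] := triangle_dichotomy gF PF T IHR.
      rewrite S7' => lt; split; [exact: ltnW|].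
      by move=> E; rewrite E in lt.
    have R0 : inside F (S :\: U) = set0.
      by apply/eqP; rewrite -cards_eq0 -leqn0; move: FR; rewrite S7'.
    rewrite FE R0 setU0; split=> // FU20; exists (S :\: U).
    rewrite subsetDl cardsD (setIidPr US) U6 S7'; split=> //.
    rewrite (sub_draws_eq (graph_on_inside gF)); last by rewrite U6.
    apply/setP=> g; rewrite !inE /turan_rule S7' /= negbK [RHS]andbCA [LHS]andbC; congr (_ && _).
    apply/idP/andP => [gU|[gS]].
      split; first exact: subset_trans US.
      by apply/eqP/setP=> w; rewrite !inE; have := subsetP gU w; rewrite !inE; case: (w \in g);
        rewrite ?andbF // => ->.
    rewrite setIDAC (setIidPr gS) => /eqP gU0; apply/subsetP=> w wg; apply: contraT => wU.
    by have := in_set0 w; rewrite -gU0 in_setD wU wg.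
  have lt : #|F| < turan #|S|.
    have S8' : 8 <= #|S| by rewrite ltn_neqAle eq_sym S8.
    have := turan_step (#|S| - 8); rewrite subnK // => step.
    apply: leq_ltn_trans step; rewrite (_ : #|S| - 8 + 2 = #|S| - 6); last by move: S8'; clear; lia.
    have [/ltnW //|FE] := triangle_dichotomy gF PF T IHR.
    by rewrite FE; apply: leq_trans (leq_card_setU _ _) (leq_add FU FR).
  by split; [exact: ltnW|move=> E; rewrite E ltnn in lt].
have LF : loose_free F.
  apply: loose_free_or_triangle gF PF _ => a b c d e f; apply: contraNN noT => T.
  by do ?[apply/existsP; eexists]; exact: T.
have [] := loose_free_bound gF LF; rewrite /loose_bound ltnNge S7 /= => bd st.
have [S7'|S8] := eqVneq #|S| 7.
  rewrite S7' /= in bd *.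
  have lt : #|F| < 20 by apply: leq_ltn_trans bd _.
  by split; [exact: ltnW|move=> E; rewrite E in lt].
have S8' : 8 <= #|S| by rewrite ltn_neqAle eq_sym S8.
rewrite /turan (leqNgt #|S|) S7 (negbTE S8) /=; split=> // E; have [s sS FE] := st S8' E.
exists [set s]; rewrite sub1set sS cards1 S7; split=> //.
rewrite FE; apply/setP=> g; rewrite !inE /turan_rule (leqNgt #|S|) S7 (negbTE S8) /=.
by do 2![congr (_ && _)]; rewrite -(setIC g) setI_eq0 -[LHS]negbK -disjoints1 disjoint_sym.
Qed.
End Turan.

(** * From families to 3-graphs *)

Section Colourings.
Variables (V W C : finType) (cV : V -> C) (cW : W -> C).

(** The vertex of [V] listed at some position of its colour class is sent to the
    vertex of [W] at the same position of the class of that colour. *)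
Lemma colour_bijection : #|V| = #|W| ->
  (forall i, #|[pred v | cV v == i]| = #|[pred w | cW w == i]|) ->
  exists2 f : V -> W, bijective f & forall v, cW (f v) = cV v.
Proof.
move=> VW classes; have [V0|] := posnP #|V|.
  have f : V -> W by move=> v; have := fintype0 v V0.
  exists f => [|v]; last by have := fintype0 v V0.
  by apply: inj_card_bij; [move=> v; have := fintype0 v V0|rewrite -VW].
rewrite VW => /card_gt0P[w0 _].
pose sV v := enum [pred u | cV u == cV v]; pose sW v := enum [pred w | cW w == cV v].
pose f v := nth w0 (sW v) (index v (sV v)).
have lt v : index v (sV v) < size (sW v).
  by rewrite -cardE -classes cardE index_mem mem_enum inE.
have fc v : cW (f v) = cV v.
  by have := mem_nth w0 (lt v); rewrite mem_enum inE => /eqP.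
exists f => //; apply: inj_card_bij; last by rewrite VW.
move=> v u fvu; have cvu : cV v = cV u by rewrite -!fc fvu.
have sVE : sV v = sV u by rewrite /sV cvu.
have sWE : sW v = sW u by rewrite /sW cvu.
have := lt v; have := lt u; move: fvu; rewrite /f sVE sWE => fvu lu lv.
move/eqP: fvu; rewrite nth_uniq ?enum_uniq // => /eqP.
by apply: (@index_inj _ u (sV u)); rewrite /sV mem_enum inE ?cvu.
Qed.
End Colourings.

Section Iso.
Implicit Types V W U : finType.

Lemma graph_on_edges V (H : graph3 V) : graph_on (edges H) setT.
Proof. by move=> e eH; rewrite subsetT; split=> //; apply/eqP/(forall_inP (edges3 H)). Qed.

Lemma iso_sym V W (H : graph3 V) (K : graph3 W) : iso H K -> iso K H.
Proof.
move=> [f [[g fK gK] fE]]; exists g; split; first by exists f.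
by move=> e; rewrite -fE -imset_comp (eq_imset _ gK) imset_id.
Qed.

Lemma iso_contains U V W (F : graph3 U) (H : graph3 V) (K : graph3 W) :
  iso H K -> contains F H = contains F K.
Proof.
suff imp V' W' (H' : graph3 V') (K' : graph3 W') : iso H' K' -> contains F H' -> contains F K'.
  by move=> HK; apply/idP/idP; apply: imp => //; apply: iso_sym.
move=> [f [/bij_inj f_inj fE]] /existsP[g /andP[/injectiveP g_inj /forall_inP gE]].
apply/existsP; exists [ffun u => f (g u)]; apply/andP; split.
  by apply/injectiveP=> u v; rewrite !ffunE => /f_inj/g_inj.
apply/forall_inP=> e /gE; rewrite -fE -imset_comp.
rewrite [X in X \in _ -> _](_ : _ = [ffun u => f (g u)] @: e) //.
by apply: eq_imset => u; rewrite ffunE.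
Qed.

Lemma iso_card_edges V W (H : graph3 V) (K : graph3 W) : iso H K -> #|edges H| = #|edges K|.
Proof.
suff imp V' W' (H' : graph3 V') (K' : graph3 W') : iso H' K' -> #|edges H'| <= #|edges K'|.
  by move=> HK; apply/eqP; rewrite eqn_leq !imp //; apply: iso_sym.
move=> [f [/bij_inj f_inj fE]].
rewrite -(card_imset _ (imset_inj f_inj)) subset_leq_card //.
by apply/subsetP=> _ /imsetP[e eH ->]; rewrite fE.
Qed.

Lemma iso_card V W (H : graph3 V) (K : graph3 W) : iso H K -> #|V| = #|W|.
Proof. by move=> [f [/bij_eq_card-> _]]. Qed.

Lemma iso_ordinal n V (H : graph3 V) : #|V| = n -> exists K : graph3 'I_n, iso H K.
Proof.
move=> Vn; pose f v : 'I_n := cast_ord Vn (enum_rank v).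
have f_bij : bijective f.
  by exists (fun i => enum_val (cast_ord (esym Vn) i)) => v;
     rewrite /f ?cast_ordK ?enum_rankK ?enum_valK ?cast_ordKV.
pose E := [set f @: e | e : {set V} in edges H].
have E3 : [forall e in E, #|e| == 3].
  apply/forall_inP=> _ /imsetP[e eH ->]; rewrite card_imset; last exact: bij_inj.
  by apply: (forall_inP (edges3 H)).
exists (Graph3 E3), f; split=> // e; rewrite /= mem_imset //.
exact: imset_inj (bij_inj f_bij).
Qed.

Lemma imset_triple V m i j k (f : 'I_m.+1 -> V) :
  f @: triple m i j k = [set f (inord i); f (inord j); f (inord k)].
Proof. by rewrite /triple !imsetU !imset_set1. Qed.

Lemma inord_uniq m (s : seq nat) : all (gtn m.+1) s ->
  uniq [seq inord i : 'I_m.+1 | i <- s] = uniq s.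
Proof.
move=> sm; rewrite map_inj_in_uniq // => i j /(allP sm) im /(allP sm) jm.
by move/(congr1 val); rewrite /= !inordK.
Qed.

Lemma nth_injective V n (s : seq V) x0 : uniq s -> size s = n ->
  injectiveb [ffun i : 'I_n => nth x0 s i].
Proof.
move=> un sn; apply/injectiveP=> i j; rewrite !ffunE => /eqP.
by rewrite nth_uniq ?sn // => /eqP/val_inj.
Qed.

Lemma path_freeP V (H : graph3 V) : reflect (path_free (edges H)) (~~ contains P33 H).
Proof.
apply: (iffP negP) => [nP x1 x2 x3 x4 x5 x6 x7 un e1 e2 e3 | PF].
  apply: nP; apply/existsP; exists [ffun i : 'I_7 => nth x1 [:: x1; x2; x3; x4; x5; x6; x7] i].
  rewrite nth_injective //=; apply/forall_inP=> e; rewrite !inE => /orP[/orP[]|] /eqP ->.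
  1-3: by rewrite imset_triple !ffunE !inordK.
move=> /existsP[f /andP[/injectiveP f_inj /forall_inP fE]].
have un := inord_uniq (m := 6) (s := iota 0 7) isT.
rewrite -(map_inj_uniq f_inj) in un.
apply: (PF _ _ _ _ _ _ _ un).
- by rewrite /edge -imset_triple; apply: fE; rewrite !inE eqxx.
- by rewrite /edge -imset_triple; apply: fE; rewrite !inE eqxx orbT.
- by rewrite /edge -imset_triple; apply: fE; rewrite !inE eqxx !orbT.
Qed.

Lemma triangleP V (H : graph3 V) :
  reflect (exists a b c d e f, triangle (edges H) a b c d e f) (contains C33 H).
Proof.
apply: (iffP existsP) => [[f /andP[/injectiveP f_inj /forall_inP fE]]|].
  have un := inord_uniq (m := 5) (s := iota 0 6) isT.
  rewrite -(map_inj_uniq f_inj) in un.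
  do 6!eexists; apply/and4P; split; first exact: un.
  - by rewrite /edge -imset_triple; apply: fE; rewrite !inE eqxx.
  - by rewrite /edge -imset_triple; apply: fE; rewrite !inE eqxx orbT.
  - have : f @: triple 5 0 4 5 \in edges H by apply: fE; rewrite !inE eqxx !orbT.
    by rewrite imset_triple -/(edge _ _ _ _) edgeCA edgeC edgeCA edgeC edgeCA.
move=> [a [b [c [d [e [f /and4P[un e1 e2 e3]]]]]]].
exists [ffun i : 'I_6 => nth a [:: a; b; c; d; e; f] i].
rewrite nth_injective //=; apply/forall_inP=> g; rewrite !inE => /orP[/orP[]|] /eqP ->.
- by rewrite imset_triple !ffunE !inordK.
- by rewrite imset_triple !ffunE !inordK.
- by rewrite imset_triple !ffunE !inordK //= -/(edge _ _ _ _); tri.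
Qed.
End Iso.

Section Extremal.
Variable V : finType.
Implicit Types (F : {set {set V}}) (S R U A g : {set V}).

Lemma graph_on_turan S A : graph_on (turan_edges S A) S.
Proof. by move=> g; rewrite inE => /and3P[gS /eqP g3 _]. Qed.

Lemma turan_edges_path_free S A : A \subset S -> #|A| = (7 <= #|S|) -> path_free (turan_edges S A).
Proof.
move=> AS A1 x1 x2 x3 x4 x5 x6 x7 un e1 e2 e3.
have g := @graph_on_turan S A.
have [h1 h2 h3] := edge_in g e1; have [_ h4 h5] := edge_in g e2; have [_ h6 h7] := edge_in g e3.
pose P := [set x in [:: x1; x2; x3; x4; x5; x6; x7]].
have P7 : #|P| = 7 by rewrite cardsE (card_uniqP un).
have PS : P \subset S.
  apply/subsetP=> x; rewrite in_set 7!in_cons in_nil orbF.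
  by do 6![case/orP=> [/eqP-> //|]]; move/eqP->.
have S7 : 7 <= #|S| by rewrite -P7 subset_leq_card.
have [s As] : exists s, A = [set s] by apply/cards1P; rewrite A1 S7.
move: e1 e2 e3; rewrite /edge !inE /turan_rule (leqNgt #|S|) S7 /=.
have meet x y z : ([set s] :&: [set x; y; z] != set0) = [|| s == x, s == y | s == z].
  by rewrite setI_eq0 disjoints1 !inE negbK orbA.
rewrite As !meet; case: ifP => [/eqP S7' | _] /and3P[_ _ a1] /and3P[_ _ a2] /and3P[_ _ a3].
  have sP : s \notin P.
    rewrite in_set 7!in_cons in_nil orbF; rewrite !negb_or in a1 a2 a3 *.
    by case/and3P: a1 => -> -> ->; case/and3P: a2 => _ -> ->; case/and3P: a3 => _ -> ->.
  have sS : s \in S by rewrite -sub1set -As.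
  have : s |: P \subset S by rewrite subUset sub1set sS.
  by move/subset_leq_card; rewrite cardsU1 sP P7 S7'.
move: un; rewrite /= !inE !negb_or.
by case/or3P: a1 => /eqP <-; case/or3P: a3 => /eqP <-; rewrite eqxx ?andbF.
Qed.

Lemma card_turan_edges S A : A \subset S -> #|A| = (7 <= #|S|) -> #|turan_edges S A| = turan #|S|.
Proof.
move=> AS A1; rewrite /turan_edges /turan_rule /turan; case: ifP => [S6|/negbT]; rewrite -?ltnNge.
  by rewrite -cards_draws; apply: eq_card => g; rewrite !inE andbT.
move=> S7; have [s As] : exists s, A = [set s] by apply/cards1P; rewrite A1 S7.
have sS : s \in S by rewrite -sub1set -As.
have meet g : ([set s] :&: g != set0) = (s \in g) by rewrite setI_eq0 disjoints1 negbK.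
case: ifP => [/eqP S7'|_]; last first.
  rewrite -(card_full_star sS); apply: eq_card => g; rewrite !inE As; do 2![congr (_ && _)].
  exact: meet.
have -> : 20 = 'C(#|S :\ s|, 3) by have := cardsD1 s S; rewrite sS S7' add1n => -[<-].
rewrite -cards_draws; apply: eq_card => g; rewrite !inE As meet.
by rewrite subsetD1 andbA -!andbA; congr (_ && _); rewrite andbC.
Qed.

(** The shape of all extremal families: a complete 3-graph on
    [U] beside an extremal family with apex [A] on the complement.  For empty [U] this
    is an extremal family on the whole vertex set. *)
Definition split_edges U A := [set g : {set V} | g \subset U & #|g| == 3] :|: turan_edges (~: U) A.

(** Consecutive edges of a path share a vertex, so a path stays on one side, and
    [U] is too small to carry one. *)
Lemma split_edges_path_free U A : #|U| <= 6 -> path_free (turan_edges (~: U) A) ->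
  path_free (split_edges U A).
Proof.
move=> U6 PF x1 x2 x3 x4 x5 x6 x7 un.
have side x y z : edge (split_edges U A) x y z ->
    [/\ x \in U, y \in U & z \in U] \/ [/\ x \notin U, y \notin U, z \notin U & edge (turan_edges
      (~: U) A) x y z].
  rewrite /edge in_setU => /orP[];
    first by rewrite inE !subUset !sub1set => /andP[/andP[/andP[? ?] ?] _]; left.
  move=> h; right; have [] := edge_in (@graph_on_turan _ _) h.
  by rewrite !in_setC.
move=> /side e1 /side e2 /side e3.
case: e2 => [[h3 h4 h5]|[h3 h4 h5 e2]]; last first.
  case: e1 => [[_ _ h]|[_ _ _ e1]]; first by rewrite h in h3.
  case: e3 => [[h _ _]|[_ _ _ e3]]; first by rewrite h in h5.
  exact: (PF _ _ _ _ _ _ _ un).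
case: e1 => [[h1 h2 _]|[_ _ + _]]; last by rewrite h3.
case: e3 => [[_ h6 h7]|[+ _ _ _]]; last by rewrite h5.
have : [set x in [:: x1; x2; x3; x4; x5; x6; x7]] \subset U.
  apply/subsetP=> x; rewrite in_set 7!in_cons in_nil orbF.
  by do 6![case/orP=> [/eqP-> //|]]; move/eqP->.
by move/subset_leq_card; rewrite cardsE (card_uniqP un) leqNgt ltnS U6.
Qed.

Lemma card_split_edges U A : #|split_edges U A| = 'C(#|U|, 3) + #|turan_edges (~: U) A|.
Proof.
rewrite -cards_draws -cardsUI; set I := _ :&: _; suff -> : I = set0 by rewrite cards0 addn0.
apply/eqP; rewrite -subset0; apply/subsetP=> g; rewrite !inE.
case/and3P=> /andP[gU /eqP g3] gUc _.
have : g \subset U :&: ~: U by rewrite subsetI gU.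
by rewrite setICr subset0 => /eqP g0; rewrite g0 cards0 in g3.
Qed.

Lemma triangle_in_six F U : #|U| = 6 -> [set g : {set V} | g \subset U & #|g| == 3] \subset F ->
  exists a b c d e f, triangle F a b c d e f.
Proof.
move=> U6 /subsetP UF; have := enum_uniq U; have : size (enum U) = 6 by rewrite -cardE.
have mem v : v \in enum U -> v \in U by rewrite mem_enum.
case: (enum U) mem => [//|a [//|b [//|c [//|d [//|e [//|f [|//]]]]]]] mem _ un.
exists a, b, c, d, e, f; apply/and4P; split=> //.
all: apply: UF; rewrite inE card3_uniq !subUset !sub1set !mem ?inE ?eqxx ?orbT //=.
all: move: un; rewrite /= !inE !negb_or => un; split_ands.
all: by repeat (apply/andP; split); first [done | neq].
Qed.
End Extremal.

(** Membership of a triple depends only on its size and on which of its vertices are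
    in [U] and in [A], so any bijection respecting these two sets is an
    isomorphism. *)
Lemma split_iso (V W : finType) (H : graph3 V) (K : graph3 W)
    (U A : {set V}) (U' A' : {set W}) :
  #|V| = #|W| -> #|U| = #|U'| -> #|A| = #|A'| -> A \subset ~: U -> A' \subset ~: U' ->
  edges H = split_edges U A -> edges K = split_edges U' A' -> iso H K.
Proof.
move=> VW UU AA AU AU' HE KE.
pose cV v := (v \in U, v \in A); pose cW w := (w \in U', w \in A').
have classes (T : finType) (B D : {set T}) i : D \subset ~: B ->
    #|[pred v | (v \in B, v \in D) == i]| =
    if i.1 then (if i.2 then 0 else #|B|) else (if i.2 then #|D| else #|T| - #|B| - #|D|).
  move=> DB; have BD v : v \in D -> v \notin B by move=> /(subsetP DB); rewrite inE.
  case: i => [[] []] /=.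
  - apply: eq_card0 => v; rewrite !inE xpair_eqE; apply/negP=> /andP[/eqP vB /eqP vD].
    by have := BD v vD; rewrite vB.
  - apply: eq_card => v; rewrite !inE xpair_eqE !eqb_id eqbF_neg.
    by case vB: (v \in B) => //=; apply/negP=> /BD; rewrite vB.
  - apply: eq_card => v; rewrite !inE xpair_eqE !eqb_id eqbF_neg.
    by case vD: (v \in D); rewrite ?andbF // BD.
  - rewrite -subnDA -(cardsC (B :|: D)) -(cardsUI B D) (_ : B :&: D = set0).
      rewrite cards0 addn0 addKn; apply: eq_card => v.
      by rewrite !inE xpair_eqE !eqbF_neg negb_or.
    by apply/eqP; rewrite setI_eq0 disjoint_sym disjoints_subset.
have [f f_bij fc] : exists2 f : V -> W, bijective f & forall v, cW (f v) = cV v.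
  apply: colour_bijection => // i; rewrite (classes V U A i AU) (classes W U' A' i AU').
  by rewrite VW UU AA.
have [fU fA] : (forall v, (f v \in U') = (v \in U)) /\ (forall v, (f v \in A') = (v \in A)).
  by split=> v; have [] := fc v.
have f_inj := bij_inj f_bij.
exists f; split=> // e; rewrite HE KE !inE (card_imset _ f_inj).
have subE (B : {set V}) (B' : {set W}) : (forall v, (f v \in B') = (v \in B)) ->
  (f @: e \subset B') = (e \subset B).
  move=> BB; apply/subsetP/subsetP=> sub v.
    by move=> ve; rewrite -BB sub // imset_f.
  by case/imsetP=> u ue ->; rewrite BB sub.
have CE : #|~: U'| = #|~: U| by have := cardsC U; have := cardsC U'; rewrite VW UU; lia.
rewrite (subE U) // (subE (~: U)); last by move=> v; rewrite !inE fU.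
by rewrite CE !setI_eq0 ![[disjoint A' & _]]disjoint_sym ![[disjoint A & _]]disjoint_sym
  !disjoints_subset (subE (~: A)) // => v; rewrite !inE fA.
Qed.

(** * The extremal 3-graphs *)

Lemma subset_imsetP (T T' : finType) (f : T -> T') (B : {pred T}) (C : {set T'}) :
  reflect (exists2 B' : {set T}, B' \subset B & C = f @: B') (C \subset f @: B).
Proof.
apply: (iffP idP) => [CB|[B' BB ->]]; last exact: imsetS.
exists [set x in B | f x \in C]; first by apply/subsetP=> x; rewrite inE => /andP[].
apply/setP=> y; apply/idP/imsetP => [yC|[x + ->]]; last by rewrite inE => /andP[].
by have /imsetP[x xB yx] := subsetP CB y yC; exists x; rewrite // inE xB -yx.
Qed.

(** The apex of the extremal 3-graph; there is none up to 6 vertices. *)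
Definition first_vertex m : {set 'I_m} := [set i : 'I_m | (i == 0 :> nat) && (7 <= m)].

Lemma card_first_vertex m : #|first_vertex m| = (7 <= m).
Proof.
case: m => [|m]; first by apply: eq_card0 => -[].
rewrite /first_vertex; case: (7 <= m.+1).
  by rewrite -[RHS](cards1 (@ord0 m)); apply: eq_card => i; rewrite !inE andbT.
by apply: eq_card0 => i; rewrite !inE andbF.
Qed.

Lemma turan_graph_subproof m :
  [forall e in turan_edges [set: 'I_m] (first_vertex m), #|e| == 3].
Proof. by apply/forall_inP=> e; rewrite inE => /and3P[]. Qed.

Definition turan_graph m : graph3 'I_m := Graph3 (turan_graph_subproof m).

Lemma turan_graph_path_free m : ~~ contains P33 (turan_graph m).
Proof.
by apply/path_freeP; apply: turan_edges_path_free;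
  rewrite ?subsetT // cardsT card_ord card_first_vertex.
Qed.

Lemma card_turan_graph m : #|edges (turan_graph m)| = turan m.
Proof. by rewrite card_turan_edges ?subsetT // cardsT card_ord // card_first_vertex. Qed.

Lemma ex3_P33 m : ex3 m P33 = turan m.
Proof.
apply/eqP; rewrite eqn_leq; apply/andP; split.
  apply/bigmax_leqP=> H /path_freeP PF.
  by have [] := turan_path (@graph_on_edges _ H) PF; rewrite cardsT card_ord.
by rewrite -card_turan_graph;
  exact: (leq_bigmax_cond (F := fun H => #|edges H|) _ (turan_graph_path_free m)).
Qed.

Lemma split_edges0 (V : finType) (A : {set V}) : split_edges set0 A = turan_edges setT A.
Proof.
apply/setP=> g; rewrite /split_edges setC0 in_setU [g \in [set _ | _]]inE subset0.
by case: eqP => [->|]; rewrite ?cards0.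
Qed.

Lemma Ex3_P33_iso (V : finType) m (H : graph3 V) : Ex3 m P33 H -> iso H (turan_graph m).
Proof.
move=> [Vm /path_freeP PF]; rewrite ex3_P33 => cH.
have [_] := turan_path (@graph_on_edges _ H) PF; rewrite cardsT Vm => /(_ cH)[A [_ A1 HE]].
apply: (@split_iso _ _ _ _ set0 A set0 (first_vertex m));
  rewrite ?setC0 ?subsetT ?cards0 ?card_ord //.
- by rewrite A1 cardsT Vm card_first_vertex.
- by rewrite split_edges0.
- by rewrite split_edges0.
Qed.

Section Disjoint.
Variables (m : nat).
Let D := dunion (complete3 6) (turan_graph m).
Let U : {set 'I_6 + 'I_m} := [set inl i | i : 'I_6].
Let A : {set 'I_6 + 'I_m} := [set inr i | i in first_vertex m].

Let inl_inj : injective (@inl 'I_6 'I_m). Proof. by move=> i j []. Qed.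
Let inr_inj : injective (@inr 'I_6 'I_m). Proof. by move=> i j []. Qed.

Let UcE : ~: U = [set inr i | i : 'I_m].
Proof.
apply/setP=> -[i|j]; rewrite !inE.
  rewrite imset_f //; apply/esym/negP=> /imsetP[] //.
by rewrite imset_f //; apply/negP=> /imsetP[].
Qed.

Lemma card_left_part : #|U| = 6.
Proof. by rewrite card_imset ?card_ord. Qed.

Lemma card_right_part : #|~: U| = m.
Proof. by rewrite UcE card_imset ?card_ord. Qed.

Lemma dunion_split : edges D = split_edges U A.
Proof.
have ruleE (d : {set 'I_m}) : (A :&: [set inr i | i in d] != set0) = (first_vertex m :&: d != set0).
  by rewrite -imsetI ?imset_eq0 //; move=> ? ? _ _; apply: inr_inj.
apply/setP=> e; rewrite /split_edges /turan_edges card_right_part !in_setU !in_set.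
congr (_ || _).
  apply/imsetP/andP => [[d]|[/subset_imsetP[d _ ->]]].
    by rewrite inE => d3 ->; rewrite card_imset // imsetS ?subset_predT.
  by rewrite card_imset // => d3; exists d; rewrite ?inE.
rewrite UcE; apply/imsetP/and3P => [[d]|[/subset_imsetP[d _ ->]]].
  by rewrite inE cardsT card_ord subsetT => /and3P[_ d3 dr] ->;
    rewrite card_imset // ruleE imsetS ?subset_predT; split.
rewrite card_imset // ruleE => d3 dr; exists d => //.
by rewrite inE cardsT card_ord subsetT d3 dr.
Qed.

Lemma apex_right : A \subset ~: U.
Proof. by rewrite UcE imsetS ?subset_predT. Qed.

Lemma card_apex : #|A| = (7 <= m).
Proof. by rewrite card_imset // card_first_vertex. Qed.

Lemma dunion_path_free : ~~ contains P33 D.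
Proof.
apply/path_freeP; rewrite dunion_split; apply: split_edges_path_free;
  first by rewrite card_left_part.
by apply: turan_edges_path_free apex_right _; rewrite card_apex card_right_part.
Qed.

Lemma dunion_triangle : contains C33 D.
Proof.
by apply/triangleP; apply: (triangle_in_six card_left_part); rewrite dunion_split subsetUl.
Qed.

Lemma card_dunion : #|edges D| = 20 + turan m.
Proof.
rewrite dunion_split card_split_edges card_left_part card_turan_edges ?card_right_part ?card_apex
  //.
exact: apex_right.
Qed.

Lemma iso_dunion (V : finType) (H : graph3 V) (U' A' : {set V}) :
  #|V| = 6 + m -> #|U'| = 6 -> #|A'| = (7 <= m) -> A' \subset ~: U' ->
  edges H = split_edges U' A' -> iso H D.
Proof.
move=> Vn U6 A1 AU HE; apply: (split_iso _ _ _ AU apex_right HE dunion_split).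
- by rewrite card_sum !card_ord.
- by rewrite card_left_part.
- by rewrite card_apex.
Qed.
End Disjoint.

(** In the alternative left by [triangle_dichotomy] the family splits along [U];
    reaching the bound forces each part to reach its own maximum. *)
Lemma triangle_bound (V : finType) (H : graph3 V) n : 6 <= n -> #|V| = n ->
  ~~ contains P33 H -> contains C33 H ->
  #|edges H| <= 20 + turan (n - 6) /\
  (#|edges H| = 20 + turan (n - 6) -> iso H (dunion (complete3 6) (turan_graph (n - 6)))).
Proof.
move=> n6 Vn /path_freeP PF /triangleP[a [b [c [d [e [f T]]]]]].
have gH := @graph_on_edges _ H.
have U6 := card_six T; set U := [set x in _] in U6.
have IH (R : {set V}) : R \subset setT :\: U -> #|inside (edges H) R| <= turan #|R|.
  move=> _; have [] // := @turan_path _ (inside (edges H) R) R (graph_on_inside gH).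
  by apply: path_free_sub PF; apply/subsetP=> g; rewrite inE => /andP[].
have [|HE] := triangle_dichotomy gH PF T IH.
  by rewrite cardsT Vn => lt; split=> [|E]; [exact: ltnW|rewrite E ltnn in lt].
rewrite -/U setTD in HE.
have R6 : #|~: U| = n - 6 by rewrite cardsCs setCK U6 Vn.
have gU := @graph_on_inside _ _ _ U gH; have gR := @graph_on_inside _ _ _ (~: U) gH.
have UU : #|inside (edges H) U| <= 20 by have := card_le_draws gU; rewrite U6.
have PR : path_free (inside (edges H) (~: U)).
  by apply: path_free_sub PF; apply/subsetP=> g; rewrite inE => /andP[].
have [RR Rext] := turan_path gR PR; rewrite R6 in RR Rext.
have le : #|edges H| <= #|inside (edges H) U| + #|inside (edges H) (~: U)|.
  by rewrite {1}HE; apply: leq_card_setU.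
split=> [|E]; first by apply: leq_trans le (leq_add UU RR).
rewrite E in le.
have U20 : #|inside (edges H) U| = 20.
  by apply/eqP; rewrite eqn_leq UU -(leq_add2r (turan (n - 6))) (leq_trans le) // leq_add2l.
have [|A [AU A1 RE]] := Rext.
  by apply/eqP; rewrite eqn_leq RR -(leq_add2l 20) -{2}U20.
apply: (iso_dunion (U' := U) (A' := A)) => //.
- by rewrite Vn subnKC.
- by rewrite A1 R6.
- by rewrite {1}HE RE (sub_draws_eq gU) // U6 U20.
Qed.

(** The disjoint union lives on a sum type, hence the detour through an isomorphic
    3-graph on ['I_n]. *)
Lemma ex3_cond_P33_C33 n : 6 <= n -> ex3_cond n P33 C33 = 20 + turan (n - 6).
Proof.
move=> n6; apply/eqP; rewrite eqn_leq; apply/andP; split.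
  apply/bigmax_leqP=> H /andP[HP HC].
  by have [] := triangle_bound n6 (card_ord n) HP HC.
have [|K DK] := @iso_ordinal n _ (dunion (complete3 6) (turan_graph (n - 6))).
  by rewrite card_sum !card_ord subnKC.
rewrite -card_dunion (iso_card_edges DK); apply: (leq_bigmax_cond (F := fun H => #|edges H|)).
by rewrite -!(iso_contains _ DK) dunion_path_free dunion_triangle.
Qed.

Theorem theorem3 (n : nat) (hn : 6 <= n) :
  ex3_cond n P33 C33 = 20 + ex3 (n - 6) P33 /\
  exists M : graph3 'I_(n - 6),
    [/\ Ex3 (n - 6) P33 M,
        forall (V : finType) (H : graph3 V), Ex3 (n - 6) P33 H -> iso H M
      & forall (V : finType) (H : graph3 V),
          Ex3_cond n P33 C33 H <-> iso H (dunion (complete3 6) M)].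
Proof.
rewrite ex3_cond_P33_C33 // ex3_P33; split=> //; exists (turan_graph (n - 6)); split.
- by rewrite /Ex3 card_ord turan_graph_path_free card_turan_graph ex3_P33.
- by move=> V H; apply: Ex3_P33_iso.
move=> V H; split=> [[Vn HP HC cH]|HD].
  by have [_] := triangle_bound hn Vn HP HC; apply; rewrite cH ex3_cond_P33_C33.
split.
- by rewrite (iso_card HD) card_sum !card_ord subnKC.
- by rewrite (iso_contains _ HD) dunion_path_free.
- by rewrite (iso_contains _ HD) dunion_triangle.
- by rewrite (iso_card_edges HD) card_dunion ex3_cond_P33_C33.
Qed.
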